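(* Let $G$ be a simple graph on vertices $v_1,\dots,v_\ell$, let $\mathcal{A}_G$ be its graphic arrangement over a field $\mathbb{K}$, and let $\mathbf{m}$ be a multiplicity on $\mathcal{A}_G$. Then the derivation complex $\mathcal{D}^\bullet(\mathcal{A}_G,\mathbf{m})$ has modules $$\mathcal{D}^i\cong\bigoplus_{\sigma\in\Delta(G)_i}S/J(\sigma),$$ and its differentials $\delta^i$ are those induced from the simplicial cochain complex of $\Delta(G)$ with coefficients in $S$, which may be identified with $\mathcal{S}^\bullet(\mathcal{A}_G)$.
   Context: $S=\mathbb{K}[x_1,\dots,x_\ell]$. The graphic arrangement $\mathcal{A}_G$ is the set of hyperplanes $H_{ij}=\{x_i=x_j\}$ in $\mathbb{K}^\ell$ with $\{v_i,v_j\}$ an edge of $G$; a multiplicity is $\mathbf{m}:\mathcal{A}_G\to\mathbb{Z}_{>0}$ and $m_{ij}=\mathbf{m}(H_{ij})$. $\Delta(G)$ is the clique complex of $G$: its $i$-simplices $\Delta(G)_i$ are the sets of $i+1$ vertices spanning a complete subgraph. For $\sigma=\{v_{i_0},\dots,v_{i_k}\}\in\Delta(G)_k$ with $k\ge1$, $J(\sigma)$ is the ideal generated by $(x_{i_s}-x_{i_t})^{m_{i_si_t}}$, $0\le s<t\le k$; for $\sigma$ a single vertex, $J(\sigma)=0$. For any multi-arrangement $(\mathcal{A},\mathbf{m})$ in $V\cong\mathbb{K}^\ell$ with defining linear forms $\alpha_H$, intersection lattice $L$ (ordered by reverse inclusion, ranked by codimension, $L_k$ the rank $k$ flats, $r$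 the rank of $\mathcal{A}$, $\mathcal{A}_X=\{H\in\mathcal{A}:X\subseteq H\}$, $\mathbf{m}_X=\mathbf{m}|_{\mathcal{A}_X}$): let $D_0(\mathcal{A},\mathbf{m})=\{\theta\in\mathrm{Der}_{\mathbb{K}}(S):\theta(\alpha_H)\in\langle\alpha_H^{\mathbf{m}(H)}\rangle\ \forall H\}$ and for $1\le k\le r$ let $D_k(\mathcal{A},\mathbf{m})$ be the cokernel of $\tau_{k-1}:D_{k-1}(\mathcal{A},\mathbf{m})\to\bigoplus_{X\in L_{k-1}}D_{k-1}(\mathcal{A}_X,\mathbf{m}_X)$, whose components are $\phi_{k-1}(X)$; for $Y\in L$ with $r(Y)\ge k$, $\phi_k(Y):D_k(\mathcal{A},\mathbf{m})\to D_k(\mathcal{A}_Y,\mathbf{m}_Y)$ is the inclusion for $k=0$ and, for $k\ge1$, the map induced on cokernels by $\phi_{k-1}(Y)$ and the projection onto the summands with $X\le Y$. Then $\mathcal{D}^k=\bigoplus_{X\in L_k}D_k(\mathcal{A}_X,\mathbf{m}_X)$ ($0\le k\le r$) and $\delta^k:\mathcal{D}^k\to\mathcal{D}^{k+1}$ is the composition $\mathcal{D}^k\to D_{k+1}(\mathcal{A},\mathbf{m})\xrightarrow{\tau_{k+1}}\mathcal{D}^{k+1}$. The modules are graded with $\partial/\partial x_i$ in degree $0$, each $\mathcal{D}^k$ is generated in degree $0$, and $\mathcal{S}^\bullet(\mathcal{A})=\mathcal{D}^\bullet(\mathcal{A},\mathbf{m})_0\otimes_{\mathbb{K}}S$ (independent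 of $\mathbf{m}$), which surjects onto $\mathcal{D}^\bullet(\mathcal{A},\mathbf{m})$. *)

(* Defs.v *)
From HB Require Import structures.
From mathcomp Require Import all_boot all_order all_algebra.
From mathcomp Require Import boolp functions.
From mathcomp Require Import freeg mpoly.

Set Implicit Arguments.
Unset Strict Implicit.
Unset Printing Implicit Defensive.

Import GRing.Theory.
Local Open Scope ring_scope.
Local Open Scope quotient_scope.

Section Submodules.
Variables (R : pzRingType) (U V : lmodType R).

Definition span (E : V -> Prop) : {pred V} := fun x =>
  `[< forall N : submodClosed V, (forall y, E y -> y \in N) -> x \in N >].

Lemma span_submod (E : V -> Prop) : submod_closed (span E).
Proof.
split=> [|a u v /asboolP hu /asboolP hv]; apply/asboolP => N hN.
  exact: rpred0.
by rewrite rpredD ?rpredZ ?hu ?hv.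
Qed.

HB.instance Definition _ (E : V -> Prop) :=
  GRing.isSubmodClosed.Build R V (span E) (span_submod E).

Lemma mem_span (E : V -> Prop) x : E x -> x \in span E.
Proof. by move=> Ex; apply/asboolP => N; apply. Qed.

Lemma span_min (E : V -> Prop) (N : submodClosed V) :
  (forall y, E y -> y \in N) -> {subset span E <= N}.
Proof. by move=> h x /asboolP; apply. Qed.

Definition kermod (f : V -> U) : {pred V} := fun x => `[< f x = 0 >].

Lemma kermod_submod (f : {linear V -> U}) : submod_closed (kermod f).
Proof.
split=> [|a u v /asboolP hu /asboolP hv]; apply/asboolP; first by rewrite linear0.
by rewrite linearP /= hu hv scaler0 addr0.
Qed.

HB.instance Definition _ (f : {linear V -> U}) :=
  GRing.isSubmodClosed.Build R V (kermod f) (kermod_submod f).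

Lemma span_kermod (E : V -> Prop) (f : {linear V -> U}) :
  (forall y, E y -> f y = 0) -> forall x, x \in span E -> f x = 0.
Proof.
move=> Ef x /asboolP/(_ (kermod f)) h; apply/asboolP/h => y Ey.
exact/asboolP/Ef.
Qed.

Definition immod (f : U -> V) : {pred V} := fun y => `[< exists x, f x = y >].

Lemma immod_submod (f : {linear U -> V}) : submod_closed (immod f).
Proof.
split=> [|a _ _ /asboolP[u <-] /asboolP[v <-]]; apply/asboolP.
  by exists 0; rewrite linear0.
by exists (a *: u + v); rewrite linearP.
Qed.

HB.instance Definition _ (f : {linear U -> V}) :=
  GRing.isSubmodClosed.Build R V (immod f) (immod_submod f).

Lemma mem_immod (f : U -> V) x : f x \in immod f.
Proof. by apply/asboolP; exists x. Qed.

End Submodules.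

Section QuotientModule.
Variables (R : pzRingType) (V : lmodType R) (N : submodClosed V).

(* The library's [submodClosed] does not inherit from the [zmodClosed] on which
   [Quotient.quot] is built. *)
Lemma submod_oppr_closed : oppr_closed N.
Proof. by move=> x xN; rewrite -scaleN1r rpredZ. Qed.

Definition submod_zmod : zmodClosed V :=
  HB.pack (N : {pred V}) (GRing.isOppClosed.Build V N submod_oppr_closed)
    (GRing.isAddClosed.Build V N (rpred0D N)).

Definition quot : Type := Quotient.quot submod_zmod.

HB.instance Definition _ := Quotient.on quot.
HB.instance Definition _ := GRing.Zmodule.on quot.

Definition quot_scale (a : R) (q : quot) : quot :=
  \pi_quot (a *: repr q).

Lemma pi_quotP (x y : V) :
  (\pi_quot x = \pi_quot y) <-> (x - y \in N).
Proof.
have -> : (x - y \in N) = (x - y \in submod_zmod) by [].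
by rewrite Quotient.idealrBE; split => [->|/eqP]. Qed.

Lemma pi_quotD (x y : V) : \pi_quot (x + y) = \pi_quot x + \pi_quot y.
Proof. exact: (raddfD (\pi_(Quotient.quot submod_zmod))). Qed.

Lemma pi_quot0 (x : V) : x \in N -> \pi_quot x = 0.
Proof.
move=> xN; rewrite -[RHS](raddf0 (\pi_(Quotient.quot submod_zmod))).
by apply/pi_quotP; rewrite subr0.
Qed.

Lemma pi_quot_scale a (x : V) :
  \pi_quot (a *: x) = quot_scale a (\pi_quot x).
Proof.
apply/pi_quotP; rewrite -scalerBr rpredZ //.
by apply/pi_quotP; rewrite reprK.
Qed.

Lemma quot_scaleA a b q : quot_scale a (quot_scale b q) = quot_scale (a * b) q.
Proof.
rewrite -[q]reprK; move: (repr q) => x.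
by rewrite -(pi_quot_scale b x) -(pi_quot_scale a) -(pi_quot_scale _ x) scalerA.
Qed.

Lemma quot_scale1 : left_id 1 quot_scale.
Proof.
move=> q; rewrite -[q]reprK; move: (repr q) => x.
by rewrite -(pi_quot_scale _ x) scale1r.
Qed.

Lemma quot_scaleDr : right_distributive quot_scale +%R.
Proof.
move=> a p q; rewrite -[p]reprK -[q]reprK; move: (repr p) (repr q) => x y.
rewrite -pi_quotD -(pi_quot_scale _ x) -(pi_quot_scale _ y) -(pi_quot_scale _ (x + y)).
by rewrite scalerDr pi_quotD.
Qed.

Lemma quot_scaleDl q : {morph quot_scale^~ q : a b / a + b}.
Proof.
move=> a b; rewrite -[q]reprK; move: (repr q) => x.
by rewrite -!(pi_quot_scale _ x) scalerDl pi_quotD.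
Qed.

HB.instance Definition _ := GRing.Zmodule_isLmodule.Build R quot
  quot_scaleA quot_scale1 quot_scaleDr quot_scaleDl.

Definition proj_quot (x : V) : quot := \pi_quot x.

Lemma proj_quot_linear : linear proj_quot.
Proof. by move=> a x y; rewrite /proj_quot pi_quotD pi_quot_scale. Qed.

HB.instance Definition _ :=
  GRing.isLinear.Build R V quot *:%R proj_quot proj_quot_linear.

Lemma proj_quotP (x y : V) : (proj_quot x = proj_quot y) <-> (x - y \in N).
Proof. exact: pi_quotP. Qed.

Variables (W : lmodType R) (f : {linear V -> W}).

Definition lift_quot (_ : forall x, x \in N -> f x = 0) (q : quot) : W :=
  f (repr q).

Hypothesis fN : forall x, x \in N -> f x = 0.

Lemma lift_quotE x : lift_quot fN (proj_quot x) = f x.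
Proof.
apply/eqP; rewrite -subr_eq0 -linearB; apply/eqP/fN.
by apply/pi_quotP; rewrite reprK.
Qed.

Lemma lift_quot_linear : linear (lift_quot fN).
Proof.
move=> a p q; have E r : r = proj_quot (repr r) by rewrite /proj_quot reprK.
by rewrite [p]E [q]E -linearP !lift_quotE linearP.
Qed.

HB.instance Definition _ :=
  GRing.isLinear.Build R quot W *:%R (lift_quot fN) lift_quot_linear.

End QuotientModule.

Arguments quot {R V} N.
Arguments proj_quot {R V} N x.

Section DirectSum.
Variables (R : pzRingType) (I : finType) (M : I -> lmodType R).

Definition dsum : Type := {dffun forall i : I, M i}.

HB.instance Definition _ := Choice.on dsum.

Definition dsum_fam (f : forall i, M i) : dsum := [ffun i => f i].

Lemma dsumE (f : forall i, M i) i : dsum_fam f i = f i.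
Proof. by rewrite /dsum_fam ffunE. Qed.

Lemma dsumP (x y : dsum) : (forall i, x i = y i) -> x = y.
Proof. by move=> e; apply/ffunP. Qed.

Definition dsum_add (x y : dsum) := dsum_fam (fun i => x i + y i).
Definition dsum_opp (x : dsum) := dsum_fam (fun i => - x i).
Definition dsum_scale (a : R) (x : dsum) := dsum_fam (fun i => a *: x i).

Lemma dsum_addA : associative dsum_add.
Proof. by move=> x y z; apply: dsumP => i; rewrite !dsumE addrA. Qed.
Lemma dsum_addC : commutative dsum_add.
Proof. by move=> x y; apply: dsumP => i; rewrite !dsumE addrC. Qed.
Lemma dsum_add0 : left_id (dsum_fam (fun=> 0)) dsum_add.
Proof. by move=> x; apply: dsumP => i; rewrite !dsumE add0r. Qed.
Lemma dsum_addN : left_inverse (dsum_fam (fun=> 0)) dsum_opp dsum_add.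
Proof. by move=> x; apply: dsumP => i; rewrite !dsumE addNr. Qed.

HB.instance Definition _ := GRing.isZmodule.Build dsum
  dsum_addA dsum_addC dsum_add0 dsum_addN.

Lemma dsum_scaleA a b x : dsum_scale a (dsum_scale b x) = dsum_scale (a * b) x.
Proof. by apply: dsumP => i; rewrite !dsumE scalerA. Qed.
Lemma dsum_scale1 : left_id 1 dsum_scale.
Proof. by move=> x; apply: dsumP => i; rewrite !dsumE scale1r. Qed.
Lemma dsum_scaleDr : right_distributive dsum_scale +%R.
Proof. by move=> a x y; apply: dsumP => i; rewrite !dsumE scalerDr. Qed.
Lemma dsum_scaleDl x : {morph dsum_scale^~ x : a b / a + b}.
Proof. by move=> a b; apply: dsumP => i; rewrite !dsumE scalerDl. Qed.

HB.instance Definition _ := GRing.Zmodule_isLmodule.Build R dsum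
  dsum_scaleA dsum_scale1 dsum_scaleDr dsum_scaleDl.

Lemma dsum_addE (x y : dsum) i : (x + y) i = x i + y i.
Proof. exact: dsumE. Qed.
Lemma dsum_scaleE a (x : dsum) i : (a *: x) i = a *: x i.
Proof. exact: dsumE. Qed.
Lemma dsum_0E i : (0 : dsum) i = 0.
Proof. exact: dsumE. Qed.
Lemma dsum_oppE (x : dsum) i : (- x) i = - x i.
Proof. exact: dsumE. Qed.

End DirectSum.

Section PolynomialScalars.
Variables (K : fieldType) (l : nat).
Local Notation S := {mpoly K[l]}.

Definition restr (M : lmodType S) : Type := M.

Section Restr.
Variable M : lmodType S.
HB.instance Definition _ := GRing.Zmodule.on (restr M).

Definition restr_scale (a : K) (x : restr M) : restr M := a%:MP *: (x : M).

Lemma restr_scaleA a b x : restr_scale a (restr_scale b x) = restr_scale (a * b) x.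
Proof. by rewrite /restr_scale scalerA mpolyCM. Qed.
Lemma restr_scale1 : left_id 1 restr_scale.
Proof. by move=> x; rewrite /restr_scale mpolyC1 scale1r. Qed.
Lemma restr_scaleDr : right_distributive restr_scale +%R.
Proof. by move=> a x y; rewrite /restr_scale scalerDr. Qed.
Lemma restr_scaleDl x : {morph restr_scale^~ x : a b / a + b}.
Proof. by move=> a b; rewrite /restr_scale mpolyCD scalerDl. Qed.

HB.instance Definition _ := GRing.Zmodule_isLmodule.Build K (restr M)
  restr_scaleA restr_scale1 restr_scaleDr restr_scaleDl.

Lemma restr_scaleE a (x : restr M) : a *: x = a%:MP *: (x : M) :> M.
Proof. by []. Qed.
End Restr.

(* [V ⊗_K S] is the free S-module on the set V modulo the relations that make
   [v |-> v ⊗ 1] a K-linear map. *)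
Section Tensor.
Variable V : lmodType K.

Definition tensor_rel (g : {freeg V / S}) : Prop :=
  exists (a : K) (u v : V),
    g = << a *: u + v >> - (a%:MP *: << u >> + << v >>).

Definition tensor : lmodType S := quot (span tensor_rel).

Definition tens (v : V) : tensor := proj_quot (span tensor_rel) << v >>.

Lemma tens_linear a u v : tens (a *: u + v) = a%:MP *: tens u + tens v.
Proof.
rewrite /tens -linearP; apply/proj_quotP/mem_span.
by exists a, u, v.
Qed.

(* The S-linear map [v ⊗ s |-> s *: f v] attached to a K-linear [f]. *)
Variables (M : lmodType S) (f : {linear V -> restr M}).

Definition free_lift (g : {freeg V / S}) : M := fglift (f : V -> M) g.

Lemma free_lift_zmod_morphism : zmod_morphism free_lift.
Proof. exact: lift_is_additive. Qed.

HB.instance Definition _ :=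
  GRing.isZmodMorphism.Build {freeg V / S} M free_lift free_lift_zmod_morphism.

Lemma free_lift_scalable : scalable free_lift.
Proof.
move=> a x; rewrite -[x]freeg_sumE.
transitivity (free_lift (\sum_(z <- dom x) a *: << coeff z x *g z >>)).
  by congr free_lift; apply: scaler_sumr.
rewrite !raddf_sum /=; apply: eq_bigr => z _; set b := coeff z x.
have -> : a *: << b *g z >> = << a * b *g z >> :> {freeg V / S}.
  by apply/eqP/freeg_eqP => w; rewrite coeffZ !coeffU mulrA.
by rewrite /free_lift !liftU scalerA.
Qed.

HB.instance Definition _ :=
  GRing.isScalable.Build S {freeg V / S} M *:%R free_lift free_lift_scalable.

Lemma free_lift0 x : x \in span tensor_rel -> free_lift x = 0.
Proof.
apply: span_kermod => _ [a [u [v ->]]].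
rewrite linearB linearP /= /free_lift !liftU !scale1r linearP.
by rewrite subrr.
Qed.

Definition tensor_lift : {linear tensor -> M} := lift_quot free_lift0.

Lemma tensor_liftE v : tensor_lift (tens v) = f v.
Proof.
apply: etrans (lift_quotE free_lift0 << v >>) _.
by rewrite /= /free_lift liftU scale1r.
Qed.

End Tensor.

Section TensorMap.
Variables (V W : lmodType K) (f : {linear V -> W}).

Definition tens_comp (v : V) : restr (tensor W) := tens (f v).

Lemma tens_comp_linear : linear tens_comp.
Proof. by move=> a u v; rewrite /tens_comp linearP tens_linear. Qed.

HB.instance Definition _ := GRing.isLinear.Build K V (restr (tensor W)) *:%R
  tens_comp tens_comp_linear.

Definition tensor_map : {linear tensor V -> tensor W} :=
  tensor_lift (tens_comp : {linear V -> restr (tensor W)}).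

End TensorMap.
End PolynomialScalars.

Definition hyperplane (K : fieldType) (l : nat) (a : 'rV[K]_l) :
    {vspace 'rV[K]_l} :=
  lker (linfun (mulmxr a^T : 'rV[K]_l -> 'rV[K]_1)).

Lemma mem_hyperplane (K : fieldType) (l : nat) (a x : 'rV[K]_l) :
  (x \in hyperplane a) = (x *m a^T == 0).
Proof. by rewrite memv_ker lfunE. Qed.

(* [lin H] is the coefficient vector of the defining form of [H]. *)
Record arrangement (K : fieldType) (l : nat) := Arrangement {
  hyp : finType;
  lin : hyp -> 'rV[K]_l;
  lin_neq0 : forall H, lin H != 0;
  hyp_inj : injective (fun H => hyperplane (lin H))
}.

Section DerivationComplex.
Variables (K : fieldType) (l : nat) (A : arrangement K l) (m : hyp A -> nat).
Local Notation S := {mpoly K[l]}.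
Implicit Types B C F : {set hyp A}.

Definition form (H : hyp A) : S := \sum_(j < l) lin H 0 j *: 'X_j.

(* A flat X of the subarrangement B is represented by the set
   B_X = {H in B : X is contained in H}, from which X is recovered as the
   intersection of the members of B_X.  Flats of B are thus subarrangements of
   B, ordered by inclusion, and (B_Y)_X = B_X whenever X <= Y. *)
Definition center B : {vspace 'rV[K]_l} :=
  (\bigcap_(H in B) hyperplane (lin H))%VS.

Definition codim B : nat := (l - \dim (center B))%N.

Definition flat B F : bool :=
  F == [set H in B | (center F <= hyperplane (lin H))%VS].

Definition flats (k : nat) B := {F : {set hyp A} | flat B F && (codim F == k)}.

Lemma flats_flat k B (X : flats k B) : flat B (val X).
Proof. by case/andP: (valP X). Qed.

Lemma mem_flat B F H : flat B F ->
  (H \in F) = (H \in B) && (center F <= hyperplane (lin H))%VS.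
Proof. by move=> /eqP E; rewrite {1}E inE. Qed.

Lemma flat_sub B F : flat B F -> F \subset B.
Proof. by move=> h; apply/subsetP => H; rewrite (mem_flat _ h) => /andP[]. Qed.

Lemma flat_trans B C F : flat B C -> flat C F -> flat B F.
Proof.
move=> hC hF; apply/eqP/setP => H; rewrite inE (mem_flat _ hF) (mem_flat _ hC).
have [FH|_] := boolP (center F <= _)%VS; last by rewrite !andbF.
rewrite !andbT (_ : (center C <= _)%VS) ?andbT //; apply: subv_trans FH.
apply/subv_bigcapP => H' /(subsetP (flat_sub hF)) H'C.
exact: bigcapv_inf H'C _.
Qed.

Definition flats_widen k B C (h : flat B C) (X : flats k C) : flats k B :=
  exist (fun F => flat B F && (codim F == k)) (val X)
    (introT andP (conj (flat_trans h (flats_flat X)) (andP (valP X)).2)).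

Definition derivation (theta : S -> S) : Prop :=
  (forall (a : K) f g, theta (a *: f + g) = a *: theta f + theta g) /\
  (forall f g, theta (f * g) = f * theta g + g * theta f).

Definition log_derivation B : {pred S -> S^o} := fun theta =>
  `[< derivation theta /\
      forall H, H \in B -> exists g, theta (form H) = g * form H ^+ m H >].

Lemma log_derivation_submod B : submod_closed (log_derivation B).
Proof.
split=> [|a u v /asboolP[[ul uM] uH] /asboolP[[vl vM] vH]].
  apply/asboolP; split; first split => *; first by rewrite scaler0 addr0.
    by rewrite !mulr0 addr0.
  by move=> H _; exists 0; rewrite mul0r.
have E f : (a *: u + v) f = a * u f + v f by [].
apply/asboolP; split; first split.
- move=> b f g; rewrite !E ul vl mulrDr -scalerAr scalerDr.
  by rewrite addrACA.
- by move=> f g; rewrite !E uM vM !mulrDr addrACA !(mulrCA a).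
- move=> H HB; have [p pE] := uH H HB; have [q qE] := vH H HB.
  by exists (a * p + q); rewrite E pE qE mulrDl mulrA.
Qed.

HB.instance Definition _ B := GRing.isSubmodClosed.Build S (S -> S^o)
  (log_derivation B) (log_derivation_submod B).

Record D0 B := MkD0 {
  D0_val :> S -> S^o;
  D0_valP : D0_val \in log_derivation B
}.

HB.instance Definition _ B := [isSub for @D0_val B].
HB.instance Definition _ B := [Choice of D0 B by <:].
HB.instance Definition _ B := [SubChoice_isSubLmodule of D0 B by <:].

Lemma log_derivationS B C : C \subset B ->
  {subset log_derivation B <= log_derivation C}.
Proof.
move=> /subsetP CB t /asboolP[tD tB]; apply/asboolP; split=> // H HC.
exact/tB/CB.
Qed.

Definition D0_map B C (h : flat B C) (t : D0 B) : D0 C :=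
  MkD0 (log_derivationS (flat_sub h) (D0_valP t)).

Lemma D0_map_linear B C (h : flat B C) : linear (D0_map h).
Proof. by move=> a x y; apply/val_inj. Qed.

HB.instance Definition _ B C (h : flat B C) :=
  GRing.isLinear.Build S (D0 B) (D0 C) *:%R (D0_map h) (D0_map_linear h).

(* d/dx_j has degree 0: the degree of theta is that of its coefficients
   theta(x_j). *)
Definition D0_hom B (d : nat) (t : D0 B) : Prop :=
  forall j : 'I_l, t 'X_j \is d.-homog.

(* The data of a fixed k: the modules D_k(B), the maps
   phi_k(Y) : D_k(B) -> D_k(B_Y) with their functoriality, which makes the maps
   phi_{k+1} well defined on cokernels, and the homogeneous elements. *)
Record layer := Layer {
  lobj : {set hyp A} -> lmodType S;
  lmap : forall B C, flat B C -> {linear lobj B -> lobj C};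
  lhom : forall B, nat -> lobj B -> Prop;
  lmap_comp : forall B C F (h : flat B C) (h' : flat C F) (h'' : flat B F) x,
    lmap h' (lmap h x) = lmap h'' x;
  lhom0 : forall B d, lhom d (0 : lobj B);
  lhomP : forall B d (a : K) (x y : lobj B),
    lhom d x -> lhom d y -> lhom d (a%:MP *: x + y);
  lhom_map : forall B C (h : flat B C) d x, lhom d x -> lhom d (lmap h x)
}.

Lemma D0_hom0 B d : D0_hom d (0 : D0 B).
Proof. by move=> j; apply: rpred0. Qed.

Lemma D0_homP B d (a : K) (x y : D0 B) :
  D0_hom d x -> D0_hom d y -> D0_hom d (a%:MP *: x + y).
Proof.
move=> hx hy j.
have E : (a%:MP *: x + y : D0 B) 'X_j = a%:MP * (x 'X_j : S) + y 'X_j by [].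
rewrite E mul_mpolyC; apply: rpredD; last exact: hy.
by apply: dhomogZ; apply: hx.
Qed.

Definition layer0 : layer.
Proof.
apply: (@Layer (fun B => D0 B) (fun B C h => D0_map h) D0_hom).
- by move=> *; apply/val_inj.
- exact: D0_hom0.
- exact: D0_homP.
- by move=> B C h d x hx j; apply: hx.
Defined.

Section NextLayer.
Variables (k : nat) (D : layer).

Definition lsum B := dsum (fun X : flats k B => lobj D (val X)).
HB.instance Definition _ B := GRing.Lmodule.on (lsum B).

Definition tau B (x : lobj D B) : lsum B :=
  dsum_fam (fun X : flats k B => lmap D (flats_flat X) x).

Lemma tau_linear B : linear (@tau B).
Proof.
move=> a x y; apply: dsumP => X.
by rewrite dsum_addE dsum_scaleE !dsumE linearP.
Qed.

HB.instance Definition _ B :=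
  GRing.isLinear.Build S (lobj D B) (lsum B) *:%R (@tau B) (@tau_linear B).

Definition lsum_proj B C (h : flat B C) (x : lsum B) : lsum C :=
  dsum_fam (fun X : flats k C => x (flats_widen h X)).

Lemma lsum_proj_linear B C (h : flat B C) : linear (lsum_proj h).
Proof.
move=> a x y; apply: dsumP => X.
by rewrite dsum_addE dsum_scaleE !dsumE.
Qed.

HB.instance Definition _ B C (h : flat B C) :=
  GRing.isLinear.Build S (lsum B) (lsum C) *:%R (lsum_proj h)
    (lsum_proj_linear h).

Lemma lsum_proj_tau B C (h : flat B C) x :
  lsum_proj h (tau x) = tau (lmap D h x).
Proof.
by apply: dsumP => X; rewrite !dsumE; apply/esym/lmap_comp.
Qed.

Definition coker_tau B : lmodType S := quot (immod (@tau B)).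

Definition coker_proj B : {linear lsum B -> coker_tau B} :=
  proj_quot (immod (@tau B)).

Lemma coker_proj_tau B x : coker_proj B (tau x) = 0.
Proof. by apply: pi_quot0; apply: mem_immod. Qed.

Lemma coker_map_subproof B C (h : flat B C) x : x \in immod (@tau B) ->
  (coker_proj C \o lsum_proj h) x = 0.
Proof. by case/asboolP => y <-; rewrite /= lsum_proj_tau coker_proj_tau. Qed.

Definition coker_map B C (h : flat B C) :
    {linear coker_tau B -> coker_tau C} :=
  lift_quot (coker_map_subproof h).

Lemma coker_mapE B C (h : flat B C) x :
  coker_map h (coker_proj B x) = coker_proj C (lsum_proj h x).
Proof. exact: (lift_quotE (coker_map_subproof h)). Qed.

Lemma coker_projP B (q : coker_tau B) : exists x, q = coker_proj B x.
Proof. by exists (repr q); rewrite /= /proj_quot reprK. Qed.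

Definition coker_hom B (d : nat) (q : coker_tau B) : Prop :=
  exists x : lsum B, (forall X, lhom d (x X)) /\ q = coker_proj B x.

Definition next_layer : layer.
Proof.
apply: (@Layer coker_tau coker_map coker_hom).
- move=> B C F h h' h'' q; have [x ->] := coker_projP q.
  rewrite !coker_mapE; congr (coker_proj F _); apply: dsumP => X.
  rewrite !dsumE; congr (x (exist _ (val X) _)); exact: bool_irrelevance.
- move=> B d; exists 0; split=> [X|]; last by rewrite linear0.
  by rewrite dsum_0E; apply: lhom0.
- move=> B d a _ _ [x [hx ->]] [y [hy ->]]; exists (a%:MP *: x + y).
  split=> [X|]; last by rewrite linearP.
  by rewrite dsum_addE dsum_scaleE; apply: lhomP.
- move=> B C h d _ [x [hx ->]]; exists (lsum_proj h x).
  by split=> [X|]; [rewrite dsumE; apply: (hx (flats_widen h X)) | rewrite coker_mapE].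
Defined.

End NextLayer.

(* D_{k+1}(B) is the cokernel of tau_k; it vanishes when k exceeds the rank
   of B. *)
Fixpoint dlayer (k : nat) : layer :=
  if k is k'.+1 then next_layer k' (dlayer k') else layer0.

Definition Dmod (k : nat) B : lmodType S := lobj (dlayer k) B.

Definition Dcpx (k : nat) : lmodType S :=
  dsum (fun X : flats k [set: hyp A] => Dmod k (val X)).

Definition delta (k : nat) : {linear Dcpx k -> Dcpx k.+1} :=
  @tau k.+1 (dlayer k.+1) [set: hyp A]
    \o coker_proj k (dlayer k) [set: hyp A].

Definition Dcpx_hom (k d : nat) (x : Dcpx k) : Prop :=
  forall X : flats k [set: hyp A], lhom d (x X).

Definition deg0 (k : nat) : {pred restr (Dcpx k)} := fun x =>
  `[< @Dcpx_hom k 0 x >].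

Arguments deg0 : clear implicits.

Lemma deg0_submod k : submod_closed (deg0 k).
Proof.
split=> [|a x y /asboolP hx /asboolP hy]; apply/asboolP => X.
  by rewrite dsum_0E; apply: lhom0.
rewrite dsum_addE restr_scaleE dsum_scaleE.
exact: lhomP.
Qed.

HB.instance Definition _ k :=
  GRing.isSubmodClosed.Build K (restr (Dcpx k)) (deg0 k) (deg0_submod k).

Record Dcpx0 (k : nat) := MkDcpx0 {
  Dcpx0_val :> restr (Dcpx k);
  Dcpx0_valP : Dcpx0_val \in deg0 k
}.

HB.instance Definition _ k := [isSub for @Dcpx0_val k].
HB.instance Definition _ k := [Choice of Dcpx0 k by <:].
HB.instance Definition _ k := [SubChoice_isSubLmodule of Dcpx0 k by <:].

Lemma delta_deg0 k (x : Dcpx k) : x \in deg0 k -> delta k x \in deg0 k.+1.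
Proof.
move=> /asboolP hx; apply/asboolP => X; rewrite dsumE; apply: lhom_map.
by exists x.
Qed.

Definition delta0 k (x : Dcpx0 k) : Dcpx0 k.+1 :=
  MkDcpx0 (delta_deg0 (Dcpx0_valP x)).

Lemma delta0_linear k : linear (@delta0 k).
Proof. by move=> a x y; apply: val_inj; apply: (linearP (delta k) a%:MP). Qed.

HB.instance Definition _ k := GRing.isLinear.Build K (Dcpx0 k) (Dcpx0 k.+1) *:%R
  (@delta0 k) (@delta0_linear k).

Definition Scpx (k : nat) : lmodType S := tensor l (Dcpx0 k).

Definition Sdelta (k : nat) : {linear Scpx k -> Scpx k.+1} :=
  tensor_map l (@delta0 k : {linear Dcpx0 k -> Dcpx0 k.+1}).

(* The surjection [v ⊗ s |-> s *: v] onto the derivation complex. *)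
Definition Scpx_surj (k : nat) : {linear Scpx k -> Dcpx k} :=
  tensor_lift (\val : {linear Dcpx0 k -> restr (Dcpx k)}).

End DerivationComplex.

Section Graphic.
Variables (K : fieldType) (l : nat) (e : rel 'I_l).
Local Notation S := {mpoly K[l]}.

(* An edge {i, j} is represented by the pair of its endpoints in increasing
   order, so that edges are in bijection with the hyperplanes x_i = x_j. *)
Definition edge := {p : 'I_l * 'I_l | (p.1 < p.2)%N && e p.1 p.2}.

Definition edge_lin (H : edge) : 'rV[K]_l :=
  delta_mx 0 (val H).1 - delta_mx 0 (val H).2.

Lemma edge_linE (H : edge) (x : 'rV[K]_l) :
  (x \in hyperplane (edge_lin H)) = (x 0 (val H).1 == x 0 (val H).2).
Proof.
rewrite mem_hyperplane /edge_lin linearB /= mulmxBr !trmx_delta -!colE subr_eq0.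
apply/eqP/eqP => [/matrixP/(_ 0 0)|E]; first by rewrite !mxE.
by apply/matrixP => i j; rewrite !mxE ord1.
Qed.

Lemma edge_lt (H : edge) : ((val H).1 < (val H).2)%N.
Proof. by case/andP: (valP H). Qed.

Lemma edge_neq (H : edge) : (val H).1 != (val H).2.
Proof. by rewrite -val_eqE neq_ltn edge_lt. Qed.

Lemma edge_lin_neq0 H : edge_lin H != 0.
Proof.
apply/eqP => /matrixP/(_ 0 (val H).1)/eqP.
by rewrite !mxE !eqxx (negPf (edge_neq H)) subr0 oner_eq0.
Qed.

Lemma edge_hyp_sub (H H' : edge) :
  hyperplane (edge_lin H) = hyperplane (edge_lin H') ->
  ((val H).1 \in [:: (val H').1; (val H').2]) &&
  ((val H).2 \in [:: (val H').1; (val H').2]).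
Proof.
move=> /vspaceP E.
have D (i : 'I_l) : (delta_mx 0 i \in hyperplane (edge_lin H)) =
    ((i == (val H).1) == (i == (val H).2)).
  by rewrite edge_linE !mxE !eqxx /= ![_ == i]eq_sym; do 2!case: (i == _);
     rewrite ?eqxx ?oner_eq0 // eq_sym oner_eq0.
have D' (i : 'I_l) : (delta_mx 0 i \in hyperplane (edge_lin H')) =
    ((i == (val H').1) == (i == (val H').2)).
  by rewrite edge_linE !mxE !eqxx /= ![_ == i]eq_sym; do 2!case: (i == _);
     rewrite ?eqxx ?oner_eq0 // eq_sym oner_eq0.
have nH := negPf (edge_neq H); rewrite !inE.
move: (D (val H).1) (D (val H).2); rewrite !E !D' !eqxx nH.
rewrite [(val H).2 == (val H).1]eq_sym nH.
by case: ((val H).1 == (val H').1); case: ((val H).1 == (val H').2);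
   case: ((val H).2 == (val H').1); case: ((val H).2 == (val H').2).
Qed.

Lemma edge_hyp_inj : injective (fun H => hyperplane (edge_lin H)).
Proof.
move=> H H' /edge_hyp_sub; rewrite !inE => sub; apply: val_inj.
move: sub (edge_neq H) (edge_lt H) (edge_lt H').
case: (val H) (val H') => [a b] [c d] /=.
case/andP=> /orP[]/eqP-> /orP[]/eqP->; rewrite ?eqxx //.
by move=> _ dc /(ltn_trans dc); rewrite ltnn.
Qed.

Definition graphic : arrangement K l := Arrangement edge_lin_neq0 edge_hyp_inj.

Lemma form_graphic (H : hyp graphic) :
  form H = 'X_((val H).1) - 'X_((val H).2).
Proof.
rewrite /form /= /edge_lin.
under eq_bigr do rewrite !mxE /= scalerBl.
rewrite big_split /= sumrN; congr (_ - _).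
  rewrite (bigD1 (val H).1) //= eqxx scale1r big1 ?addr0 // => j /negPf jH.
  by rewrite jH scale0r.
rewrite (bigD1 (val H).2) //= eqxx scale1r big1 ?addr0 // => j /negPf jH.
by rewrite jH scale0r.
Qed.

Definition clique (s : {set 'I_l}) : bool :=
  [forall i in s, forall j in s, (i != j) ==> e i j].

Definition simplex (k : nat) :=
  {s : {set 'I_l} | (#|s| == k.+1) && clique s}.

Definition cochain (k : nat) : lmodType S := dsum (fun s : simplex k => S^o).

Definition position (s : {set 'I_l}) (i : 'I_l) : nat :=
  #|[set j in s | (j < i)%N]|.

Lemma face_subproof k (s : simplex k.+1) (i : 'I_l) : i \in val s ->
  (#|val s :\ i| == k.+1) && clique (val s :\ i).
Proof.
case: s => s /= /andP[/eqP cs /forall_inP qs] is_.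
rewrite -eqSS -[X in _ == X]cs (cardsD1 i s) is_ eqxx /=.
apply/forall_inP => a; rewrite inE => /andP[_ a_s].
apply/forall_inP => b; rewrite inE => /andP[_ b_s].
by have /forall_inP/(_ b b_s) := qs a a_s.
Qed.

Definition face k (s : simplex k.+1) (i : {i | i \in val s}) : simplex k :=
  exist (fun s : {set 'I_l} => (#|s| == k.+1) && clique s) (val s :\ val i)
    (face_subproof (valP i)).

Definition coboundary (k : nat) (c : cochain k) : cochain k.+1 :=
  dsum_fam (fun s : simplex k.+1 =>
    \sum_(i : {i | i \in val s}) (-1) ^+ position (val s) (val i) * c (face i)).

Variable m : hyp graphic -> nat.

Definition J (s : {set 'I_l}) : {pred S^o} :=
  span (fun f : S^o => exists H : hyp graphic,
    [/\ (val H).1 \in s, (val H).2 \in s &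
        f = ('X_((val H).1) - 'X_((val H).2)) ^+ m H]).

HB.instance Definition _ s := GRing.SubmodClosed.on (J s).

Definition cochainJ (k : nat) : lmodType S :=
  dsum (fun s : simplex k => quot (J (val s))).

Definition reduceJ (k : nat) (c : cochain k) : cochainJ k :=
  dsum_fam (fun s : simplex k => proj_quot (J (val s)) (c s)).

(* Computed on representatives; well defined by [coboundaryJE]. *)
Definition coboundaryJ (k : nat) (q : cochainJ k) : cochainJ k.+1 :=
  reduceJ (coboundary (dsum_fam (fun s : simplex k => repr (q s)))).

Lemma J_sub (s t : {set 'I_l}) : s \subset t -> {subset J s <= J t}.
Proof.
move=> /subsetP st; apply: span_min => _ [H [H1 H2 ->]].
by apply: mem_span; exists H; rewrite !st.
Qed.

Lemma coboundaryJE k (c : cochain k) :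
  coboundaryJ (reduceJ c) = reduceJ (coboundary c).
Proof.
apply: dsumP => s; rewrite !dsumE; apply/proj_quotP.
rewrite -sumrB; apply: rpred_sum => i _; rewrite -mulrBr.
apply: rpredZ; apply: (@J_sub (val (face i))); first exact: subD1set.
by rewrite !dsumE; apply/proj_quotP; rewrite /proj_quot reprK.
Qed.

End Graphic.

(* Main.v *)
From HB Require Import structures.
Require Import Defs.
From mathcomp Require Import all_boot all_order all_algebra.
From mathcomp Require Import boolp functions.
From mathcomp Require Import freeg mpoly.
Set Implicit Arguments.
Unset Strict Implicit.
Unset Printing Implicit Defensive.
Import GRing.Theory.
Local Open Scope ring_scope.

(** Let a cochain be any function from the sets of vertices to S, with its
    simplicial coboundary d, and call a clique of a set of edges B a set of
    vertices whose pairs are all edges of B.  For every k and every B, the sum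
    of the modules D_k(B_X) over the rank k flats X of B is presented by the
    cochains: there is a surjection from the cochains onto it whose kernel is
    { c | c(s) lies in J(s) for every clique s of B with k + 1 vertices }.
    For B the set of all edges this gives the sum of the S/J(s), that is, the
    isomorphism psi.

    The presentations are built by induction on k ([presP]).  As D_{k+1}(B) is
    the cokernel of tau_k, it too is a quotient of the cochains, and it remains
    to find the kernel when C = B_X has rank k + 1.  It consists of the c such
    that (d c)(s) lies in J(s) for every clique s of C with k + 2 vertices
    ([rank_kernel]): then c |-> (d c)(s) identifies D_{k+1}(C) with S/J(s) if
    C has such a clique s, and D_{k+1}(C) = 0 if it has none.  In this
    description tau_{k+1} becomes c |-> d c, which is why the differential of
    the derivation complex is the simplicial one ([next_pres_tau]).

    For k = 0 the kernel is found by hand: a cochain gives the derivation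
    sending x_i to c{i}, and it is logarithmic along x_i = x_j exactly when
    c{j} - c{i} lies in J{i, j} ([pres0_rank]).  For k > 0 the image of tau_k
    is the image of the coboundaries, and two cases arise.
    - C has a clique s with k + 2 vertices.  By rank reasons C is the complete
      graph on s ([clique_full]).  The full simplex is a cone, so a cochain on
      its facets is, up to a coboundary, determined by its own coboundary at s
      ([coker_pres_cone]); and each generator of J(s) comes from an edge, which
      lies in a facet of s, so J(s) is already killed ([coker_pres_cone_J]).
    - C has none.  Then each clique of C with k + 1 vertices has a facet that
      no other such clique contains ([free_facet]), hence each cochain is a
      coboundary on these cliques ([coker_pres_no_clique]).

    Finally, elements of degree 0 correspond to cochains with values in K at
    every step of the induction.  No nonzero constant lies in J(s) because the
    multiplicities are positive ([J_const]), so the degree 0 part of the k-th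
    module has the k-simplices as a K-basis, and tensoring with S gives the
    simplicial cochains: this is the isomorphism chi. *)

(** * Quotients and linear maps *)

Section LinearMaps.
Variable R : pzRingType.

(** For functions whose linearity is only worth a local proof. *)
Definition linear_of (U V : lmodType R) (f : U -> V) (f_lin : linear f) :
    {linear U -> V} :=
  HB.pack f (GRing.isLinear.Build R U V *:%R f f_lin).

(** The modules of the theorem are only known through surjections onto them;
    maps out of them are all produced by this factorisation. *)
Lemma linear_factor (U V W : lmodType R) (p : {linear U -> V})
    (q : {linear U -> W}) :
    (forall v, exists u, p u = v) -> (forall u, p u = 0 -> q u = 0) ->
  {f : {linear V -> W} | forall u, f (p u) = q u}.
Proof.
move=> p_onto ker_pq; pose g v := sval (cid (p_onto v)).
have gK v : p (g v) = v by rewrite /g; case: cid.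
have qE u u' : p u = p u' -> q u = q u'.
  by move=> E; apply/eqP; rewrite -subr_eq0 -linearB ker_pq // linearB E subrr.
have f_lin : linear (q \o g).
  by move=> a v w /=; rewrite -linearP; apply: qE; rewrite linearP !gK.
by exists (linear_of f_lin) => u /=; apply: qE.
Qed.

Lemma linear_factor_bij (U V W : lmodType R) (p : {linear U -> V})
    (q : {linear U -> W}) (f : {linear V -> W}) :
    (forall v, exists u, p u = v) -> (forall w, exists u, q u = w) ->
    (forall u, q u = 0 -> p u = 0) -> (forall u, f (p u) = q u) -> bijective f.
Proof.
move=> p_onto q_onto ker_qp fE.
have [g gE] := linear_factor q_onto ker_qp.
exists g => [v|w].
  by have [u <-] := p_onto v; rewrite fE gE.
by have [u <-] := q_onto w; rewrite gE fE.
Qed.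

End LinearMaps.

Lemma proj_quot_eq0 (R : pzRingType) (V : lmodType R) (N : submodClosed V)
    (x : V) : proj_quot N x = 0 <-> x \in N.
Proof. by rewrite -(linear0 (proj_quot N)) proj_quotP subr0. Qed.

Lemma tensor_ext (K : fieldType) (l : nat) (V : lmodType K)
    (M : lmodType {mpoly K[l]}) (f g : {linear tensor l V -> M}) :
  (forall v, f (tens l v) = g (tens l v)) -> f =1 g.
Proof.
move=> fg q; have -> : q = proj_quot (Defs.span (@tensor_rel K l V)) (repr q).
  by rewrite /proj_quot reprK.
move: (repr q) => x; rewrite -[x]freeg_sumE !linear_sum /=.
apply: eq_bigr => z _; set b := coeff z x.
have -> : << b *g z >> = b *: << z >> :> {freeg V / {mpoly K[l]}}.
  by apply/eqP/freeg_eqP => w; rewrite coeffZ !coeffU mul1r.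
by rewrite !linearZ /= -[proj_quot _ _]/(tens l z) fg.
Qed.

(** * Cochains on sets of vertices *)
Section SetCochains.
Variables (R : comNzRingType) (n : nat).
Implicit Types (c : {ffun {set 'I_n} -> R^o}) (s t : {set 'I_n}).

(** Cochains are defined on all sets of vertices, whether or not they are
    simplices, so that every subgraph and every degree share one domain. *)
Definition cobound c : {ffun {set 'I_n} -> R^o} :=
  [ffun s : {set 'I_n} => \sum_(i in s) (-1) ^+ position s i * c (s :\ i)].

Lemma cobound_linear : linear cobound.
Proof.
move=> a c c'; apply/ffunP => s; rewrite !ffunE scaler_sumr -big_split /=.
by apply: eq_bigr => i _; rewrite !ffunE mulrDr -!scalerAr.
Qed.

HB.instance Definition _ := GRing.isLinear.Build R
  {ffun {set 'I_n} -> R^o} {ffun {set 'I_n} -> R^o} *:%R cobound cobound_linear.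

Lemma coboundBE c c' s : cobound (c - c') s = cobound c s - cobound c' s.
Proof. by rewrite linearB !ffunE. Qed.

Definition single t (r : R^o) : {ffun {set 'I_n} -> R^o} :=
  [ffun u => if u == t then r else 0].

Lemma single_linear t : linear (single t).
Proof.
move=> a r r'; apply/ffunP => s; rewrite !ffunE.
by case: eqP => // _; rewrite scaler0 addr0.
Qed.

HB.instance Definition _ t := GRing.isLinear.Build R
  R^o {ffun {set 'I_n} -> R^o} *:%R (single t) (single_linear t).

Lemma position_D1 s (i j : 'I_n) : i \in s ->
  position s j = ((i < j)%N + position (s :\ i) j)%N.
Proof.
move=> i_s; rewrite /position (cardsD1 i) inE i_s /=; congr (_ + _)%N.
by apply: eq_card => h; rewrite !inE andbA.
Qed.

(** Removing i and then j from s gets the sign of the two positions in s, with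
    one further sign change if i < j; so the terms for (i, j) and (j, i)
    cancel. *)
Lemma cobound_cobound c s : cobound (cobound c) s = 0.
Proof.
pose T (i j : 'I_n) : R :=
  (-1) ^+ (position s i + position s j) * c (s :\ i :\ j).
have E : cobound (cobound c) s =
    \sum_(i in s) (\sum_(j in s | (j < i)%N) T i j
                 - \sum_(j in s | (i < j)%N) T i j).
  rewrite ffunE; apply: eq_bigr => i i_s.
  rewrite ffunE (bigID (fun j : 'I_n => (j < i)%N)) /= mulrDr !mulr_sumr -sumrN.
  congr (_ + _); apply: eq_big => [j|j].
  - by rewrite !inE; case: (eqVneq j i) => [->|_] /=; rewrite ?ltnn ?andbF.
  - move=> /andP[_ ji]; rewrite mulrA -exprD /T (position_D1 j i_s).
    by rewrite ltnNge (ltnW ji).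
  - rewrite !inE -leqNgt ltn_neqAle -(val_eqE j i) eq_sym.
    by case: (j \in s); rewrite ?andbF ?andbT.
  move=> /andP[]; rewrite !inE -leqNgt => /andP[ji _] ij.
  have lt_ij : (i < j)%N by rewrite ltn_neqAle eq_sym val_eqE ji.
  rewrite mulrA -exprD /T (position_D1 j i_s) lt_ij addnCA.
  by rewrite addSn add0n exprS mulN1r mulNr opprK.
rewrite E sumrB; apply/eqP; rewrite subr_eq0; apply/eqP.
rewrite (exchange_big_dep (mem s)) /=; last by move=> i j _ /andP[].
apply: eq_bigr => j j_s; apply: eq_big => [i|i _]; first by rewrite j_s.
rewrite /T addnC; congr (_ * c _).
by apply/setP => h; rewrite !inE andbCA.
Qed.

Lemma cobound_single s (i : 'I_n) r : i \in s ->
  cobound (single (s :\ i) r) s = (-1) ^+ position s i * r.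
Proof.
move=> i_s; rewrite ffunE (bigD1 i) //= ffunE eqxx big1 ?addr0 // => j.
case/andP=> j_s ji; rewrite ffunE; case: eqP => [/setP/(_ i)|_].
  by rewrite !inE eqxx i_s eq_sym ji.
by rewrite mulr0.
Qed.

(** The facet opposite to the smallest vertex; removing that vertex comes with
    the sign +1, so no signs appear in [cobound_single_base] and
    [link_base]. *)
Definition base s := [set i in s | position s i != 0].

Lemma baseP s : s != set0 ->
  exists2 v, v \in s & position s v = 0 /\ base s = s :\ v.
Proof.
case/set0Pn => i0 i0s; case: (arg_minnP (@nat_of_ord n) i0s) => v vs v_min.
have {}vs : v \in s := vs; have pos_v : position s v = 0%N.
  apply/eqP; rewrite cards_eq0; apply/eqP/setP => j; rewrite !inE.
  by apply/negP => /andP[/v_min]; rewrite leqNgt => /negP.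
exists v => //; split=> //; apply/setP => j; rewrite !inE andbC.
have [js|_] := boolP (j \in s); rewrite ?andbF // !andbT.
have [->|jv] := eqVneq j v; first by rewrite pos_v.
apply/idP; rewrite -lt0n.
apply/card_gt0P; exists v; rewrite inE vs ltn_neqAle v_min //.
by rewrite eq_sym val_eqE jv.
Qed.

Lemma cobound_single_base s r : s != set0 -> cobound (single (base s) r) s = r.
Proof.
by case/baseP=> v vs [pv ->]; rewrite cobound_single // pv expr0 mul1r.
Qed.

Lemma cobound_single0 s t r :
  (forall i, i \in s -> s :\ i != t) -> cobound (single t r) s = 0.
Proof.
by move=> h; rewrite ffunE big1 // => i /h /negPf E; rewrite ffunE E mulr0.
Qed.

Lemma sum_single c : c = \sum_t single t (c t).
Proof.
apply/ffunP => s; rewrite sum_ffunE (bigD1 s) //= ffunE eqxx.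
by rewrite big1 ?addr0 // => t; rewrite ffunE eq_sym => /negPf->.
Qed.

(** The contracting homotopy of a cone with apex v. *)
Definition link (v : 'I_n) c : {ffun {set 'I_n} -> R^o} :=
  [ffun t : {set 'I_n} => if v \in t then 0 else c (v |: t)].

Lemma cobound_link v c s : v \in s -> position s v = 0%N ->
  cobound (link v c) s = c s.
Proof.
move=> vs pv; rewrite ffunE (bigD1 v) //= pv expr0 mul1r ffunE !inE eqxx /=.
rewrite setD1K // big1 ?addr0 // => i /andP[_ iv].
by rewrite ffunE !inE eq_sym iv vs mulr0.
Qed.

Lemma position0_sub v s t : t \subset s -> position s v = 0%N ->
  position t v = 0%N.
Proof.
move=> ts /eqP pv; apply/eqP; rewrite -leqn0 -(eqP pv).
apply: subset_leq_card; apply/subsetP => j.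
by rewrite !inE => /andP[/(subsetP ts)->].
Qed.

(** c - d (link v c) has the same coboundary as c and vanishes on the facets
    of s through v, by [cobound_link]; the facet opposite to v therefore
    accounts for the whole coboundary at s. *)
Lemma link_base v c s : v \in s -> position s v = 0%N ->
  c (s :\ v) - cobound (link v c) (s :\ v) = cobound c s.
Proof.
move=> vs pv; rewrite -[RHS]subr0 -(cobound_cobound (link v c) s) -coboundBE.
rewrite [RHS]ffunE (bigD1 v) //= pv expr0 mul1r big1 => [|i /andP[i_s iv]].
  by rewrite addr0 !ffunE.
have vi : v \in s :\ i by rewrite !inE eq_sym iv.
have E0 : cobound (link v c) (s :\ i) = c (s :\ i).
  by apply: cobound_link => //; apply: position0_sub pv; apply: subD1set.
have -> : (c - cobound (link v c)) (s :\ i) =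
    c (s :\ i) - cobound (link v c) (s :\ i).
  by rewrite !ffunE.
by rewrite E0 subrr mulr0.
Qed.

End SetCochains.

Lemma facetP (T : finType) k (s t : {set T}) :
  t \subset s -> #|t| = k -> #|s| = k.+1 -> exists2 i, i \in s & t = s :\ i.
Proof.
move=> ts card_t card_s; have : #|s :\: t| == 1%N.
  by rewrite cardsD (setIidPr ts) card_s card_t subSnn.
case/cards1P=> i Ei; have : i \in s :\: t by rewrite Ei inE.
case/setDP=> i_s it; exists i => //; rewrite -Ei.
by rewrite setDDr setDv set0U (setIidPr ts).
Qed.

(** * Cliques and the rank of graphic flats *)
Section CliquesAndRank.
Variables (K : fieldType) (l : nat) (e : rel 'I_l).
Local Notation A := (graphic K e).
Implicit Types (B C : {set hyp A}) (s t : {set 'I_l}).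

Definition within s : {set hyp A} :=
  [set H : hyp A | ((val H).1 \in s) && ((val H).2 \in s)].

Definition clique_in B s : bool :=
  [forall i in s, forall j in s,
     (i < j)%N ==> [exists H in B, val H == (i, j)]].

Lemma clique_inP B s : reflect
  (forall i j : 'I_l, i \in s -> j \in s -> (i < j)%N ->
    exists2 H, H \in B & val H = (i, j)) (clique_in B s).
Proof.
apply: (iffP forall_inP) => [h i j i_s j_s ij|h i i_s].
  have /forall_inP/(_ j j_s)/implyP/(_ ij)/exists_inP[H HB /eqP] := h i i_s.
  by exists H.
apply/forall_inP => j j_s; apply/implyP => ij; apply/exists_inP.
by have [H HB HE] := h i j i_s j_s ij; exists H => //; apply/eqP.
Qed.

Lemma clique_inS B C s t : B \subset C -> t \subset s ->
  clique_in B s -> clique_in C t.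
Proof.
move=> /subsetP BC /subsetP ts /clique_inP h; apply/clique_inP => i j it jt ij.
by have [H HB HE] := h i j (ts i it) (ts j jt) ij; exists H => //; apply: BC.
Qed.

Lemma clique_in1 B i : clique_in B [set i].
Proof.
by apply/clique_inP => a b; rewrite !inE => /eqP-> /eqP->; rewrite ltnn.
Qed.

Lemma within_sub B s : clique_in B s -> within s \subset B.
Proof.
move=> /clique_inP h; apply/subsetP => H; rewrite inE => /andP[H1 H2].
have [H' HB' HE] := h _ _ H1 H2 (edge_lt H).
by have -> : H = H' by apply: val_inj; rewrite HE; case: (val H).
Qed.

Lemma clique_within B s : clique_in B s -> clique_in (within s) s.
Proof.
move=> /clique_inP h; apply/clique_inP => i j i_s j_s ij.
have [H HB HE] := h i j i_s j_s ij.
by exists H => //; rewrite inE HE /= i_s.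
Qed.

Lemma clique_in_edge B s i : clique_in B s -> i \in s -> (1 < #|s|)%N ->
  exists2 H, H \in within s & (i == (val H).1) || (i == (val H).2).
Proof.
move=> /clique_within/clique_inP h i_s; rewrite (cardsD1 i) i_s ltnS.
case/card_gt0P => j; rewrite !inE => /andP[ji j_s].
case: (ltngtP i j) => [ij|ij|/val_inj E]; last by rewrite E eqxx in ji.
  by have [H HB HE] := h i j i_s j_s ij; exists H; rewrite // HE eqxx.
by have [H HB HE] := h j i j_s i_s ij; exists H; rewrite // HE eqxx orbT.
Qed.

Lemma clique_within_sub s t : clique_in (within s) t -> (1 < #|t|)%N ->
  t \subset s.
Proof.
move=> ct card_t; apply/subsetP => i it.
have [H Ht /orP[]/eqP->] := clique_in_edge ct it card_t.
  by have := subsetP (within_sub ct) H Ht; rewrite inE => /andP[].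
by have := subsetP (within_sub ct) H Ht; rewrite inE => /andP[].
Qed.

(** Recovers the clique from the flat that it spans, see [verts_within]. *)
Definition verts B : {set 'I_l} :=
  \bigcup_(H in B) [set (val H).1; (val H).2].

Lemma verts_within B s : clique_in B s -> (1 < #|s|)%N -> verts (within s) = s.
Proof.
move=> cs card_s; apply/setP => i; apply/bigcupP/idP => [[H]|i_s].
  by rewrite !inE => /andP[H1 H2] /orP[]/eqP->.
by have [H Hs Hi] := clique_in_edge cs i_s card_s; exists H; rewrite // !inE.
Qed.

(** The points with equal coordinates on s.  For a clique s it is the center
    of [within s], but it is also needed for s that are not cliques. *)
Definition diag s : {vspace 'rV[K]_l} :=
  (\bigcap_(p : 'I_l * 'I_l | (p.1 \in s) && (p.2 \in s))
     hyperplane (delta_mx 0 p.1 - delta_mx 0 p.2)%R)%VS.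

Lemma mem_hyperplane_delta (i j : 'I_l) (x : 'rV[K]_l) :
  (x \in hyperplane (delta_mx 0 i - delta_mx 0 j)) = (x 0 i == x 0 j).
Proof.
rewrite mem_hyperplane linearB /= mulmxBr !trmx_delta -!colE subr_eq0.
apply/eqP/eqP => [/matrixP/(_ 0 0)|E]; first by rewrite !mxE.
by apply/matrixP => a b; rewrite !mxE ord1.
Qed.

Lemma mem_diag s (x : 'rV[K]_l) : reflect
  (forall i j, i \in s -> j \in s -> x 0 i = x 0 j) (x \in diag s).
Proof.
rewrite memvE; apply: (iffP subv_bigcapP) => [h i j i_s j_s|h [i j] /=].
  have := h (i, j); rewrite /= i_s j_s -memvE mem_hyperplane_delta.
  by move=> /(_ isT)/eqP.
by case/andP=> i_s j_s; rewrite -memvE mem_hyperplane_delta (h i j).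
Qed.

Lemma mem_center B (x : 'rV[K]_l) : reflect
  (forall H, H \in B -> x 0 (val H).1 = x 0 (val H).2) (x \in center B).
Proof.
rewrite memvE; apply: (iffP subv_bigcapP) => h H HB.
  by have := h H HB; rewrite -memvE edge_linE => /eqP.
by rewrite -memvE edge_linE h.
Qed.

Lemma delta_diag s (i : 'I_l) : i \notin s -> delta_mx 0 i \in diag s.
Proof.
move=> i_s; apply/mem_diag => a b a_s b_s; rewrite !mxE /=.
by do 2 (case: eqP => [E|_]; first by rewrite E (negPf i_s) in a_s b_s).
Qed.

Lemma diag_sub_hyperplane s (H : hyp A) :
  (diag s <= hyperplane (lin H))%VS = (H \in within s).
Proof.
apply/subvP/idP => [h|]; last first.
  rewrite inE => /andP[H1 H2] x /mem_diag/(_ _ _ H1 H2) E.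
  by rewrite edge_linE E.
rewrite inE; apply/andP; split; apply/negPn/negP => /delta_diag/h.
  rewrite edge_linE !mxE !eqxx /= [(val H).2 == _]eq_sym (negPf (edge_neq H)).
  by rewrite oner_eq0.
by rewrite edge_linE !mxE !eqxx /= (negPf (edge_neq H)) eq_sym oner_eq0.
Qed.

(** Each further vertex v imposes one equation x_v = x_w, which is not already
    satisfied because the basis vector of v violates it. *)
Lemma dim_diag s : s != set0 -> (\dim (diag s) + #|s| = l.+1)%N.
Proof.
have [n] := ubnP #|s|; elim: n s => // n IHn s; rewrite ltnS => s_n.
case/set0Pn => v vs.
have [s'0|] := eqVneq (s :\ v) set0.
  have -> : diag s = fullv.
    apply/vspaceP => x; rewrite memvf; apply/mem_diag => i j.
    by rewrite -(setD1K vs) s'0 setU0 !inE => /eqP-> /eqP->.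
  by rewrite (cardsD1 v) vs s'0 cards0 dimvf /dim /= mul1n addn1.
move=> s'N0; have lt_s : (#|s :\ v| < n)%N.
  by apply: leq_trans s_n; rewrite [X in (_ < X)%N](cardsD1 v) vs.
have dim_s' := IHn _ lt_s s'N0; rewrite (cardsD1 v s) vs add1n.
rewrite addnS -addSn -dim_s'; congr (_ + _)%N.
case/set0Pn: s'N0 => w; rewrite !inE => /andP[wv ws].
pose f : 'Hom('rV[K]_l, 'rV[K]_1) :=
  linfun (mulmxr (delta_mx 0 v - delta_mx 0 w)^T : 'rV[K]_l -> 'rV[K]_1).
have -> : diag s = (diag (s :\ v) :&: lker f)%VS.
  apply/vspaceP => x; rewrite memv_cap -[lker f]/(hyperplane _).
  rewrite mem_hyperplane_delta; apply/mem_diag/andP => [h|[/mem_diag h /eqP E]].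
    split; last by rewrite (h v w).
    apply/mem_diag => i j; rewrite !inE => /andP[_ i_s] /andP[_ j_s].
    exact: h.
  have h' i : i \in s -> x 0 i = x 0 w.
    move=> i_s; have [->|iv] := eqVneq i v => //.
    by apply: h; rewrite !inE ?iv ?wv.
  by move=> i j /h'-> /h'->.
rewrite -[RHS](limg_ker_dim f) -addn1; congr (_ + _)%N; apply/esym/eqP.
have le1 : (\dim (f @: diag (s :\ v)) <= 1)%N.
  by apply: leq_trans (dimvS (subvf _)) _; rewrite dimvf.
rewrite eqn_leq le1 /= lt0n dimv_eq0; apply/negP => /eqP f0.
have : f (delta_mx 0 v) \in (f @: diag (s :\ v))%VS.
  by apply: memv_img; apply: delta_diag; rewrite !inE eqxx.
rewrite f0 memv0 lfunE /= => /eqP/matrixP/(_ 0 0).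
rewrite linearB /= mulmxBr !trmx_delta -!colE !mxE !eqxx /= (negPf wv) subr0.
by move/eqP; rewrite oner_eq0.
Qed.

Lemma center_sub_diag B s : clique_in B s -> (center B <= diag s)%VS.
Proof.
move=> /clique_inP cs; apply/subvP => x /mem_center h; apply/mem_diag.
have E i j : i \in s -> j \in s -> (i < j)%N -> x 0 i = x 0 j.
  by move=> i_s j_s /(cs i j i_s j_s)[H /h + HE]; rewrite HE.
move=> i j i_s j_s; case: (ltngtP i j) => [||/val_inj->] //; first exact: E.
by move=> ji; rewrite (E j i).
Qed.

Lemma center_within B s : clique_in B s -> center (within s) = diag s.
Proof.
move=> cs; apply/eqP; rewrite eqEsubv (center_sub_diag (clique_within cs)) /=.
by apply/subv_bigcapP => H Hs; rewrite diag_sub_hyperplane.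
Qed.

Lemma dim_center_codim C : (\dim (center C) + codim C = l)%N.
Proof.
rewrite subnKC //; apply: leq_trans (dimvS (subvf _)) _.
by rewrite dimvf /dim /= mul1n.
Qed.

Lemma center_eq_diag C s k : codim C = k -> #|s| = k.+1 ->
  (center C <= diag s)%VS -> center C = diag s.
Proof.
move=> rk card_s Cs; apply/eqP; rewrite eqEdim Cs /=.
have s0 : s != set0 by rewrite -card_gt0 card_s.
have := dim_diag s0; rewrite card_s addnS => -[E].
by rewrite -(leq_add2r k) E -rk dim_center_codim.
Qed.

(** The center of C is contained in [diag s] and has the same dimension, so the
    hyperplanes of C, all containing the center, join two vertices of s. *)
Lemma clique_full C s k : codim C = k -> #|s| = k.+1 -> clique_in C s ->
  C = within s.
Proof.
move=> rk card_s cs; apply/eqP; rewrite eqEsubset within_sub // andbT.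
apply/subsetP => H HC; rewrite -diag_sub_hyperplane.
rewrite -(center_eq_diag rk card_s (center_sub_diag cs)).
exact: bigcapv_inf HC _.
Qed.

Lemma clique_flat B s k : clique_in B s -> #|s| = k.+1 ->
  flat B (within s) && (codim (within s) == k).
Proof.
move=> cs card_s; apply/andP; split.
  apply/eqP/setP => H; rewrite inE (center_within cs) diag_sub_hyperplane.
  by case: (boolP (H \in within s)) => [/(subsetP (within_sub cs))->|];
     rewrite ?andbF.
have s0 : s != set0 by rewrite -card_gt0 card_s.
have := dim_diag s0; rewrite card_s addnS -(center_within cs) => -[E].
by rewrite -(eqn_add2l (\dim (center (within s)))) dim_center_codim E.
Qed.

(** Suppose that every facet s - i lies in another clique of the same size,
    obtained by replacing i with some v.  The edges of both cliques force the
    coordinates on v and s to agree, which already uses up the rank of C; hence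
    v is the same for all i.  Two choices of i then show that v is adjacent to
    all of s, so that s together with v is a clique that is too large. *)
Lemma free_facet C s k : codim C = k.+2 ->
  (forall t, #|t| = k.+3 -> ~~ clique_in C t) -> clique_in C s -> #|s| = k.+2 ->
  exists2 i, i \in s &
    forall t, clique_in C t -> #|t| = k.+2 -> s :\ i \subset t -> t = s.
Proof.
move=> rk no_clique cs card_s.
have [/exists_inP[i i_s /forallP h]|/exists_inPn no_free] := boolP
  [exists i in s, forall t,
     clique_in C t && (#|t| == k.+2) && (s :\ i \subset t) ==> (t == s)].
  exists i => // t ct card_t sit; apply/eqP/(implyP (h t)).
  by rewrite ct card_t eqxx.
have nbr i : i \in s -> exists v, [/\ v \notin s, clique_in C (v |: s :\ i)
    & center C = diag (v |: s)].
  move=> i_s; have := no_free i i_s; rewrite negb_forall => /existsP[t].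
  rewrite negb_imply => /andP[/andP[/andP[ct /eqP card_t] sit] ts].
  have card_si : #|s :\ i| = k.+1.
    by apply/eqP; rewrite -eqSS -card_s (cardsD1 i s) i_s.
  have card_d : #|t :\: (s :\ i)| = 1%N.
    by rewrite cardsD (setIidPr sit) card_t card_si subSS subSnn.
  have /eqP/cards1P[v Ev] := card_d.
  have Et : t = v |: s :\ i.
    by rewrite -Ev -{1}(setID t (s :\ i)) (setIidPr sit) setUC.
  have /setDP[vt vsi] : v \in t :\: (s :\ i) by rewrite Ev inE.
  have vs : v \notin s.
    apply: contra ts => vs; rewrite eqEcard card_s card_t leqnn andbT Et.
    by apply/subsetP => j; rewrite !inE => /orP[/eqP->|/andP[]].
  exists v; split; rewrite -?Et //.
  apply: center_eq_diag rk _ _; first by rewrite cardsU1 vs card_s.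
  have /card_gt0P[w wsi] : (0 < #|s :\ i|)%N by rewrite card_si.
  apply/subvP => x xC; have /mem_diag xs := subvP (center_sub_diag cs) x xC.
  have /mem_diag xt := subvP (center_sub_diag ct) x xC.
  have xw j : j \in v |: s -> x 0 j = x 0 w.
    have wt := subsetP sit w wsi; move: wsi; rewrite inE => /andP[_ ws].
    by rewrite !inE => /orP[/eqP->|]; [exact: xt | move/xs; apply].
  by apply/mem_diag => a b /xw-> /xw->.
have /card_gt0P[i is_] : (0 < #|s|)%N by rewrite card_s.
have /card_gt0P[j] : (0 < #|s :\ i|)%N.
  by have := cardsD1 i s; rewrite is_ card_s add1n => -[<-].
rewrite !inE => /andP[ji js].
have [v [vs cv Cv]] := nbr i is_; have [w [ws cw Cw]] := nbr j js.
have wv : w = v.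
  apply: contraNeq ws => wv.
  have [ws //|ws] := boolP (w \in s).
  have : delta_mx 0 w \in diag (w |: s).
    by rewrite -Cw Cv delta_diag // !inE negb_or wv.
  move=> /mem_diag/(_ w i); rewrite !inE eqxx is_ orbT !mxE !eqxx /=.
  move=> /(_ isT isT)/eqP.
  have [E|_] := eqVneq i w; first by rewrite -E is_ in ws.
  by rewrite oner_eq0.
rewrite wv in cw.
have card_vs : #|v |: s| = k.+3 by rewrite cardsU1 vs card_s.
case/negP: (no_clique _ card_vs).
(* A pair in s + v misses i or j or lies in s, so one of the three cliques
   contains it. *)
have cases a b : a \in v |: s -> b \in v |: s -> a != b ->
    [\/ (a \in s) && (b \in s), (a \in v |: s :\ i) && (b \in v |: s :\ i)
      | (a \in v |: s :\ j) && (b \in v |: s :\ j)].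
  rewrite !inE; have [->|av] /= := eqVneq a v; have [->|bv] /= := eqVneq b v.
  - by [].
  - move=> _ bs _; have [->|bi] := eqVneq b i; last by apply: Or32.
    by apply: Or33; rewrite eq_sym ji.
  - move=> a_s _ _; have [->|ai] := eqVneq a i.
      by apply: Or33; rewrite eq_sym ji is_.
    by apply: Or32; rewrite a_s.
  - by move=> -> -> _; apply: Or31.
apply/clique_inP => a b avs bvs ab; have := cases a b avs bvs.
rewrite neq_ltn ab => /(_ isT)[] /andP[a_t b_t].
- exact: (elimT (clique_inP C s) cs).
- exact: (elimT (clique_inP C _) cv).
- exact: (elimT (clique_inP C _) cw).
Qed.

Lemma clique_setT k (s : {set 'I_l}) : (forall i j, e i j = e j i) ->
  (#|s| == k) && clique e s = (#|s| == k) && clique_in setT s.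
Proof.
move=> e_sym; congr (_ && _).
apply/forall_inP/clique_inP => [h i j i_s j_s ij|h i i_s].
  have /forall_inP/(_ j j_s) := h i i_s.
  rewrite neq_ltn ij /= => eij.
  have Hp : (i < j)%N && e i j by rewrite ij.
  pose P (p : 'I_l * 'I_l) := (p.1 < p.2)%N && e p.1 p.2.
  by exists (exist P (i, j) Hp).
apply/forall_inP => j j_s; apply/implyP; rewrite neq_ltn => /orP[] ij.
  by have [H _ HE] := h i j i_s j_s ij; have := valP H; rewrite HE => /andP[].
have [H _ HE] := h j i j_s i_s ij.
by have := valP H; rewrite HE e_sym => /andP[].
Qed.

End CliquesAndRank.

(** * Derivations of the polynomial ring *)
Section Derivations.
Variables (K : fieldType) (l : nat).
Local Notation S := {mpoly K[l]}.

Lemma derivationB (u : S -> S) f g : derivation u -> u (f - g) = u f - u g.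
Proof. by case=> uL _; rewrite addrC -scaleN1r uL scaleN1r addrC. Qed.

(** By the Leibniz rule, the polynomials on which two derivations agree form a
    subalgebra containing the variables. *)
Lemma derivation_ext (u v : S -> S) : derivation u -> derivation v ->
  (forall j : 'I_l, u 'X_j = v 'X_j) -> u =1 v.
Proof.
have der1 w : derivation w -> w 1 = 0.
  case=> _ wM; have := wM 1 1; rewrite !mul1r => /eqP.
  by rewrite -subr_eq subrr eq_sym => /eqP.
have der0 w : derivation w -> w 0 = 0.
  by case=> _ wM; rewrite -[0 in LHS](mulr0 0) wM !mul0r addr0.
move=> hu hv uvX; have [uL uM] := hu; have [vL vM] := hv.
elim/mpolyind => [|a k p _ _ IHp]; first by rewrite !der0.
rewrite uL vL IHp; congr (_ *: _ + _); rewrite mpolyXE_id.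
apply: (big_ind (fun f => u f = v f)); first by rewrite !der1.
  by move=> f g Ef Eg; rewrite uM vM Ef Eg.
move=> i _; elim: (k i) => [|n IHn]; first by rewrite !expr0 !der1.
by rewrite exprS uM vM IHn uvX.
Qed.

Definition coord_der (c : 'I_l -> S) : S -> S^o :=
  fun f => \sum_(j < l) c j * f^`M(j).

Lemma coord_derX c i : coord_der c 'X_i = c i.
Proof.
rewrite /coord_der (bigD1 i) //= big1 ?addr0 => [|j ji]; rewrite mderivX mnm1E.
  rewrite eqxx scale1r (_ : (_ - _)%MM = 0%MM) ?mpolyX0 ?mulr1 //.
    by apply/mnmP => h; rewrite mnmBE mnm0E subnn.
by rewrite eq_sym (negPf ji) scale0r mulr0.
Qed.

Lemma coord_der_derivation c : derivation (coord_der c).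
Proof.
split=> [a f g|f g]; rewrite /coord_der.
  rewrite scaler_sumr -big_split; apply: eq_bigr => j _.
  by rewrite linearP mulrDr scalerAr.
rewrite !mulr_sumr -big_split; apply: eq_bigr => j _ /=.
by rewrite mderivM mulrDr addrC !mulrA [c j * f]mulrC [c j * _ * g]mulrC mulrA.
Qed.

End Derivations.

(** * The ideals J *)
Section IdealsOfCliques.
Variables (K : fieldType) (l : nat) (e : rel 'I_l).
Variable m : hyp (graphic K e) -> nat.
Local Notation S := {mpoly K[l]}.
Local Notation A := (graphic K e).

Lemma J_vertex (s : {set 'I_l}) f : (#|s| <= 1)%N -> f \in J m s -> f = 0.
Proof.
move=> s1; pose idS : {linear S^o -> S^o} := idfun.
apply: (span_kermod (f := idS)) => g [H [H1 H2 _]].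
have /card_le1_eqP/(_ _ _ H1 H2) := s1 => E12.
by have := edge_neq H; rewrite E12 eqxx.
Qed.

(** The pairs of increasing endpoints determine the edges, so the ideal of an
    edge has a single generator. *)
Lemma J_edge (H : hyp A) f :
  f \in J m [set (val H).1; (val H).2] <-> exists g, f = g * Defs.form H ^+ m H.
Proof.
pose q : S^o := Defs.form H ^+ m H.
have q_lin : linear (fun g : S^o => g *: q).
  by move=> a g g'; rewrite scalerDl scalerA.
have E : {subset J m [set (val H).1; (val H).2] <= immod (linear_of q_lin)}.
  apply: span_min => _ [H' [H1 H2 ->]]; apply/asboolP; exists 1.
  rewrite /= scale1r /q form_graphic; suff -> : H = H' by [].
  apply: val_inj; move: H1 H2 (edge_lt H') (edge_lt H); rewrite !inE.
  case: (val H) (val H') => [a b] [a' b'] /=.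
  case/orP=> /eqP-> /orP[] /eqP->; rewrite ?ltnn //.
  by move=> ba ab; have := ltn_trans ba ab; rewrite ltnn.
split=> [/E/asboolP[g <-]|[g ->]]; first by exists g.
apply: (rpredZ g); apply: mem_span; exists H.
by rewrite !inE !eqxx orbT form_graphic.
Qed.

(** The maximal ideal at the origin, which contains every J(s) as soon as the
    multiplicities are positive. *)
Definition vanish0 : {pred S^o} := fun f : S => f@_0%MM == 0.

Lemma vanish0_submod : submod_closed vanish0.
Proof.
split=> [|a u v]; rewrite -!topredE /= /vanish0 ?mcoeff0 //.
move=> /eqP u0 /eqP v0; rewrite mcoeffD.
by rewrite (rmorphM (mcoeff 0%MM)) /= u0 v0 mulr0 addr0.
Qed.

HB.instance Definition _ :=
  GRing.isSubmodClosed.Build S S^o vanish0 vanish0_submod.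

(** Each generator x_i - x_j, raised to a positive power, vanishes at the
    origin. *)
Lemma J_const s a : (forall H, (0 < m H)%N) -> a%:MP \in J m s -> a = 0.
Proof.
move=> m_pos; suff sub : {subset J m s <= vanish0}.
  by move=> /sub; rewrite -topredE /= /vanish0 mcoeffC eqxx mulr1 => /eqP.
apply: span_min => _ [H [_ _ ->]]; rewrite -topredE /= /vanish0.
rewrite -(prednK (m_pos H)) exprS (rmorphM (mcoeff 0%MM)) /= mcoeffB !mcoeffX.
by rewrite !mnm1_eq0 subrr mul0r.
Qed.

End IdealsOfCliques.

(** * From one layer to the next *)
Section Presentation.
Variables (K : fieldType) (l : nat) (e : rel 'I_l).
Variable m : hyp (graphic K e) -> nat.
Local Notation S := {mpoly K[l]}.
Local Notation A := (graphic K e).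
Local Notation Coch := {ffun {set 'I_l} -> S^o}.
Implicit Types (B C : {set hyp A}) (s t : {set 'I_l}).

Definition constc (a : {ffun {set 'I_l} -> K^o}) : Coch :=
  [ffun s => (a s)%:MP].

Lemma cobound_constc a : cobound (constc a) = constc (cobound a).
Proof.
apply/ffunP => s; rewrite !ffunE rmorph_sum /=; apply: eq_bigr => i _.
by rewrite ffunE rmorphM /= rmorphXn /= rmorphN1.
Qed.

Lemma single_constc t b : single t b%:MP = constc (single t b).
Proof. by apply/ffunP => s; rewrite !ffunE; case: eqP. Qed.

(** The invariant of the induction on layers: q identifies the sum of the
    D_k(B_X) with the cochains on the cliques with k + 1 vertices modulo J.
    Naturality in B is what makes the next cokernel map computable, and the
    last two fields follow the elements of degree 0. *)
Record presents k (D : layer A) (q : forall B, {linear Coch -> lsum k D B}) :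
    Prop := Presents {
  pres_nat : forall B C (h : flat B C) c, lsum_proj h (q B c) = q C c;
  pres_ker : forall B c, q B c = 0 <->
    (forall s, clique_in B s -> #|s| = k.+1 -> c s \in J m s);
  pres_onto : forall B (y : lsum k D B), exists c, q B c = y;
  pres_hom : forall B a X, lhom 0 (q B (constc a) X);
  pres_onto_hom : forall B (y : lsum k D B), (forall X, lhom 0 (y X)) ->
    exists a, q B (constc a) = y
}.

Section NextLayer.
Variables (k : nat) (D : layer A) (q : forall B, {linear Coch -> lsum k D B}).

Definition coker_pres B : {linear Coch -> coker_tau k D B} :=
  coker_proj k D B \o q B.

(** In other words, c |-> (d c)(s) embeds D_{k+1}(C) into the sum of the S/J(s)
    over the cliques s of C with k + 2 vertices; at most one s occurs, by
    [clique_full]. *)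
Definition rank_kernel : Prop := forall C, codim C = k.+1 ->
  forall c, coker_pres C c = 0 <->
    (forall s, clique_in C s -> #|s| = k.+2 -> cobound c s \in J m s).

Lemma coker_pres_onto (q_pres : presents q) B y : exists c, coker_pres B c = y.
Proof.
have [x ->] := coker_projP y; have [c <-] := pres_onto q_pres x.
by exists c.
Qed.

Lemma coker_pres_nat (q_pres : presents q) B C (h : flat B C) c :
  lmap (next_layer k D) h (coker_pres B c) = coker_pres C c.
Proof.
apply: etrans (coker_mapE h (q B c)) _.
exact: (congr1 (fun x => coker_proj k D C x) (pres_nat q_pres h c)).
Qed.

(** A cochain c acts on the summand of X through its value at the clique
    spanned by X.  The element of D_{k+1}(B_X) attached to this value is the
    class of any cochain whose coboundary at the clique is that value; the one
    concentrated on the base facet is linear in it.  If X does not come from a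
    clique, D_{k+1}(B_X) vanishes and the value is immaterial. *)
Definition next_fun B (c : Coch) : lsum k.+1 (next_layer k D) B :=
  dsum_fam (fun X : flats k.+1 B => coker_pres (val X)
    (single (base (verts (val X))) (c (verts (val X))))
     : lobj (next_layer k D) (val X)).

Lemma next_fun_linear B : linear (@next_fun B).
Proof.
move=> a c c'; apply: dsumP => X.
rewrite dsum_addE dsum_scaleE !dsumE; set v := verts _.
rewrite (linearP (single (base v)) a (c v) (c' v)).
by rewrite [LHS](linearP (coker_pres (val X))).
Qed.

Definition next_pres B : {linear Coch -> lsum k.+1 (next_layer k D) B} :=
  linear_of (@next_fun_linear B).

Lemma next_presE B c X : next_pres B c X =
  coker_pres (val X) (single (base (verts (val X))) (c (verts (val X)))).
Proof. exact: dsumE. Qed.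

Hypotheses (q_pres : presents q) (q_rank : rank_kernel).

Lemma coker_pres_eq C c c' : codim C = k.+1 ->
  (forall s, clique_in C s -> #|s| = k.+2 -> cobound c s = cobound c' s) ->
  coker_pres C c = coker_pres C c'.
Proof.
move=> rk E; apply/eqP; rewrite -subr_eq0 -linearB; apply/eqP/(q_rank rk).
by move=> s cs card_s; rewrite coboundBE E // subrr rpred0.
Qed.

Lemma codim_flats B (X : flats k.+1 B) : codim (val X) = k.+1.
Proof. by have /andP[_ /eqP] := valP X. Qed.

Lemma clique_flat_verts B (X : flats k.+1 B) s :
  clique_in (val X) s -> #|s| = k.+2 ->
  val X = within K e s /\ verts (val X) = s.
Proof.
move=> cs card_s; have E := clique_full (codim_flats X) card_s cs.
by rewrite E (verts_within cs) // card_s.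
Qed.

Lemma next_pres_cone B (c : Coch) (X : flats k.+1 B) s :
  clique_in (val X) s -> #|s| = k.+2 ->
  cobound (single (base (verts (val X))) (c (verts (val X)))) s = c s.
Proof.
move=> cs card_s; have [_ ->] := clique_flat_verts cs card_s.
by rewrite cobound_single_base // -card_gt0 card_s.
Qed.

(** tau_{k+1} sends the class of c to its class in each D_{k+1}(B_X), which
    only depends on d c at the clique of X. *)
Lemma next_pres_tau B c :
  tau k.+1 (coker_pres B c : lobj (next_layer k D) B) = next_pres B (cobound c).
Proof.
apply: dsumP => X; rewrite dsumE coker_pres_nat // next_presE.
apply: coker_pres_eq => [|s cs card_s]; first exact: codim_flats.
by rewrite next_pres_cone.
Qed.

(** A cochain inducing the class of f X on every summand X at once; distinct
    flats spanned by cliques have distinct cliques.  It is stated over any ring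
    so as to apply to cochains with values in K as well. *)
Definition glue (R : comNzRingType) B
    (f : flats k.+1 B -> {ffun {set 'I_l} -> R^o}) : {ffun {set 'I_l} -> R^o} :=
  [ffun s => if insub (within K e s) is Some X then cobound (f X) s else 0].

Lemma next_pres_glue B (f : flats k.+1 B -> Coch) (X : flats k.+1 B) :
  next_pres B (glue f) X = coker_pres (val X) (f X).
Proof.
rewrite next_presE; apply: coker_pres_eq => [|s cs card_s].
  exact: codim_flats.
rewrite next_pres_cone // ffunE; have [<- _] := clique_flat_verts cs card_s.
by rewrite valK.
Qed.

(** The cliques of B with k + 2 vertices are exactly those of its flats of rank
    k + 1, and surjectivity, for all elements or for those of degree 0, is
    obtained by gluing representatives of the summands. *)
Lemma next_presents : presents next_pres.
Proof.
split.
- by move=> B C h c; apply: dsumP => X; rewrite dsumE !next_presE.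
- move=> B c; split=> [c0 s cs card_s|cJ].
    pose X : flats k.+1 B := exist _ (within K e s) (clique_flat cs card_s).
    have := next_presE c X; rewrite c0 dsum_0E => /esym.
    move=> /(q_rank (codim_flats X))/(_ s (clique_within cs) card_s).
    by rewrite (next_pres_cone c (X := X)) //; apply: clique_within cs.
  apply: dsumP => X; rewrite dsum_0E next_presE.
  apply/(q_rank (codim_flats X)) => s cs card_s.
  rewrite next_pres_cone //; apply: cJ => //; apply: clique_inS cs => //.
  exact: flat_sub (flats_flat X).
- move=> B y.
  have /choice[f fE] (X : flats k.+1 B) : exists c, coker_pres (val X) c = y X.
    exact: coker_pres_onto.
  by exists (glue f); apply: dsumP => X; rewrite next_pres_glue fE.
- move=> B a X; rewrite next_presE ffunE single_constc.
  set b := single _ _; exists (q (val X) (constc b)).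
  by split=> // Y; apply: (pres_hom q_pres).
- move=> B y y_hom.
  have /choice[f fE] (X : flats k.+1 B) :
      exists a, coker_pres (val X) (constc a) = y X.
    have [x [/(pres_onto_hom q_pres)[a <-] ->]] := y_hom X.
    by exists a.
  exists (glue f); apply: dsumP => X; rewrite -fE.
  rewrite -[RHS](next_pres_glue (fun X => constc (f X))).
  congr (next_pres B _ X).
  apply/ffunP => s; rewrite !ffunE; case: insub => [Y|]; last exact: mpolyC0.
  by apply/esym; rewrite cobound_constc [LHS]ffunE.
Qed.

End NextLayer.

(** Here D is a layer of positive index, whose modules are quotients p of the
    cochains with tau induced by the coboundary. *)
Section RankStep.
Implicit Types (c b : Coch).
Variables (k : nat) (D : layer A).
Variable q : forall B, {linear Coch -> lsum k.+1 D B}.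
Variable p : forall B, {linear Coch -> lobj D B}.
Hypotheses (q_pres : presents q) (p_onto : forall B y, exists c, p B c = y).
Hypothesis p_tau : forall B c, tau k.+1 (p B c) = q B (cobound c).

Lemma J_cobound c s : (forall i, i \in s -> c (s :\ i) \in J m (s :\ i)) ->
  cobound c s \in J m s.
Proof.
move=> h; rewrite ffunE; apply: rpred_sum => i i_s.
apply: (rpredZ ((-1) ^+ position s i)); apply: (@J_sub _ _ _ _ (s :\ i)).
  exact: subD1set.
exact: h.
Qed.

(** The classes of coboundaries vanish because they come from tau, and those of
    cochains with values in J vanish because q kills them. *)
Lemma coker_pres_boundary C c b :
  (forall t, clique_in C t -> #|t| = k.+2 -> c t - cobound b t \in J m t) ->
  coker_pres q C c = 0.
Proof.
move=> h; have E : q C c = tau k.+1 (p C b).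
  rewrite p_tau; apply/eqP; rewrite -subr_eq0 -linearB; apply/eqP.
  apply/(pres_ker q_pres) => t ct card_t.
  have -> : (c - cobound b) t = c t - cobound b t by rewrite !ffunE.
  exact: h.
apply: etrans (congr1 (fun x => coker_proj k.+1 D C x) E) _.
exact: coker_proj_tau.
Qed.

(** As d d = 0, subtracting a coboundary does not change the coboundary of c;
    and the latter is a signed sum of values of c at facets, whose ideals J are
    contained in J(s). *)
Lemma coker_pres_kernel C c s :
  coker_pres q C c = 0 -> clique_in C s -> #|s| = k.+3 ->
  cobound c s \in J m s.
Proof.
move=> c0 cs card_s.
have [x tx] : exists x, tau k.+1 x = q C c.
  exact/asboolP/(proj_quot_eq0 (immod (tau k.+1 (D := D) (B := C)))).
have [b bx] := p_onto x; move: tx; rewrite -bx p_tau => /esym/eqP.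
rewrite -subr_eq0 -linearB => /eqP/(pres_ker q_pres) h.
have -> : cobound c s = cobound (c - cobound b) s.
  by rewrite coboundBE cobound_cobound subr0.
apply: J_cobound => i i_s; apply: h.
  by apply: clique_inS cs => //; apply: subD1set.
by apply/eqP; rewrite -eqSS -card_s (cardsD1 i s) i_s.
Qed.

(** A cochain concentrated on one clique is the coboundary of one concentrated
    on its free facet. *)
Lemma coker_pres_no_clique C c : codim C = k.+2 ->
  (forall t, #|t| = k.+3 -> ~~ clique_in C t) -> coker_pres q C c = 0.
Proof.
move=> rk no_clique; rewrite [c]sum_single linear_sum big1 // => s _.
have [/andP[cs /eqP card_s]|] := boolP (clique_in C s && (#|s| == k.+2));
    last first.
  rewrite negb_and => not_s.
  apply: (coker_pres_boundary (b := 0)) => t ct card_t.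
  rewrite linear0 !ffunE subr0; case: eqP => [Et|_]; last exact: rpred0.
  by rewrite -Et ct card_t eqxx in not_s.
have [i i_s free] := free_facet rk no_clique cs card_s.
pose r : S := (-1) ^+ position s i * c s.
apply: (coker_pres_boundary (b := single (s :\ i) r)) => t ct card_t.
rewrite ffunE; case: (eqVneq t s) => [->|ts].
  by rewrite cobound_single // /r signrMK subrr rpred0.
rewrite cobound_single0 ?subrr ?rpred0 // => h ht; apply: contraNneq ts => E.
by apply/eqP/free => //; rewrite -E subD1set.
Qed.

(** It suffices to kill the generator y attached to an edge.  Since s has at
    least three vertices, one of them, i, is off the edge, and y lies in the
    ideal of the facet s - i.  If i is the apex v this is the base facet.
    Otherwise the coboundary of a cochain concentrated on s - v - i moves y
    from the base facet to the facet s - i. *)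
Lemma coker_pres_cone_J C s g :
  C = within K e s -> clique_in C s -> #|s| = k.+3 ->
  g \in J m s -> coker_pres q C (single (base s) g) = 0.
Proof.
move=> EC cs card_s.
have s0 : s != set0 by rewrite -card_gt0 card_s.
have [v vs [pv Eb]] := baseP s0.
have facet t : clique_in C t -> #|t| = k.+2 -> exists2 j, j \in s & t = s :\ j.
  move=> ct card_t; apply: (facetP _ card_t card_s).
  by apply: (@clique_within_sub K l e); [rewrite -EC | rewrite card_t].
pose F : {linear S^o -> coker_tau k.+1 D C} :=
  coker_pres q C \o single (base s).
suff F0 : forall y, y \in J m s -> F y = 0 by exact: F0.
apply: span_kermod => y [H [H1 H2 Ey]]; rewrite /F /= Eb.
have yJ i : i != (val H).1 -> i != (val H).2 -> y \in J m (s :\ i).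
  move=> iH1 iH2; apply: mem_span; exists H.
  by rewrite !inE H1 H2 ![_ == i]eq_sym iH1 iH2.
have [i i_s /andP[iH1 iH2]] :
    exists2 i, i \in s & (i != (val H).1) && (i != (val H).2).
  have : (0 < #|s :\ (val H).1 :\ (val H).2|)%N.
    have := card_s; rewrite (cardsD1 (val H).1) H1 add1n => -[] /=.
    rewrite (cardsD1 (val H).2) !inE H2 eq_sym (edge_neq H) add1n => -[] /= ->.
    by [].
  case/card_gt0P => i; rewrite !inE => /and3P[i2 i1 i_s].
  by exists i; rewrite // i1.
have [iv|iv] := eqVneq i v.
  apply: (coker_pres_boundary (b := 0)) => t _ _; rewrite linear0 !ffunE subr0.
  by case: eqP => [->|_]; [apply: yJ; rewrite -iv | apply: rpred0].
have i_sv : i \in s :\ v by rewrite !inE iv.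
pose r : S := (-1) ^+ position (s :\ v) i * y.
apply: (coker_pres_boundary (b := single (s :\ v :\ i) r)) => t ct card_t.
have [j js ->] := facet t ct card_t; rewrite ffunE.
have [->|jv] := eqVneq j v.
  by rewrite eqxx cobound_single // /r signrMK subrr rpred0.
have /negPf-> : s :\ j != s :\ v.
  by apply/eqP => /setP/(_ v); rewrite !inE eqxx vs eq_sym jv.
rewrite sub0r rpredN; have [->|ji] := eqVneq j i.
  have -> : s :\ v :\ i = s :\ i :\ v by apply/setP => h; rewrite !inE andbCA.
  rewrite cobound_single; last by rewrite !inE eq_sym iv.
  by rewrite /r mulrA -exprD; apply: (rpredZ ((-1) ^+ _)); apply: yJ.
rewrite cobound_single0 ?rpred0 // => h _; apply/eqP => /setP/(_ j).
by rewrite !inE eqxx js ji jv andbF.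
Qed.

(** The difference of the two cochains is the coboundary of [link v c] on the
    facets of s. *)
Lemma coker_pres_cone C c s :
  C = within K e s -> clique_in C s -> #|s| = k.+3 ->
  coker_pres q C c = coker_pres q C (single (base s) (cobound c s)).
Proof.
move=> EC cs card_s; apply/eqP; rewrite -subr_eq0 -linearB; apply/eqP.
have s0 : s != set0 by rewrite -card_gt0 card_s.
have [v vs [pv Eb]] := baseP s0.
apply: (coker_pres_boundary (b := link v c)) => t ct card_t.
have ts : t \subset s.
  by apply: (@clique_within_sub K l e); [rewrite -EC | rewrite card_t].
have [i i_s Et] := facetP ts card_t card_s.
have -> : (c - single (base s) (cobound c s)) t =
    c t - (if t == s :\ v then cobound c s else 0) by rewrite Eb !ffunE.
rewrite addrAC Et; have [->|iv] := eqVneq i v.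
  by rewrite eqxx link_base // subrr rpred0.
have vi : v \in s :\ i by rewrite !inE eq_sym iv.
rewrite cobound_link //; last by apply: position0_sub pv; apply: subD1set.
have /negPf-> : s :\ i != s :\ v.
  by apply: contraTneq vi => ->; rewrite !inE eqxx.
by rewrite subrr subr0 rpred0.
Qed.

Lemma rank_ker_step : rank_kernel q.
Proof.
move=> C rk c; split=> [c0 s cs card_s|cJ].
  exact: coker_pres_kernel c0 cs card_s.
have [/existsP[s /andP[cs /eqP card_s]]|] :=
  boolP [exists s : {set 'I_l}, clique_in C s && (#|s| == k.+3)].
  have EC := clique_full rk card_s cs.
  by rewrite (coker_pres_cone c EC cs card_s) coker_pres_cone_J // cJ.
rewrite negb_exists => /forallP no_clique.
apply: coker_pres_no_clique => // t card_t.
by have := no_clique t; rewrite card_t eqxx andbT.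
Qed.

End RankStep.
End Presentation.

(** * The layer of derivations, and all layers *)
Section Layers.
Variables (K : fieldType) (l : nat) (e : rel 'I_l).
Variable m : hyp (graphic K e) -> nat.
Local Notation S := {mpoly K[l]}.
Local Notation A := (graphic K e).
Local Notation Coch := {ffun {set 'I_l} -> S^o}.
Implicit Types (B C : {set hyp A}) (s t : {set 'I_l}) (c : Coch).

Lemma codim0 B : codim B = 0%N -> B = set0.
Proof.
move=> rk; have full : center B = fullv.
  apply/eqP; rewrite eqEdim subvf dimvf /dim /= mul1n.
  by have := dim_center_codim B; rewrite rk addn0 => ->.
apply/setP => H; rewrite inE; apply/negP => HB.
have : delta_mx 0 (val H).1 \in center B by rewrite full memvf.
move=> /mem_center/(_ H HB)/eqP.
rewrite !mxE !eqxx eq_sym [_ == (val H).1]eq_sym.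
by rewrite /= (negPf (edge_neq H)) eq_sym oner_eq0.
Qed.

Lemma flats0 B (X : flats 0 B) : val X = set0.
Proof. by apply: codim0; have /andP[_ /eqP] := valP X. Qed.

Definition vert_der c : S -> S^o := coord_der (fun i => c [set i]).

Lemma vert_der_linear a c c' :
  vert_der (a *: c + c') = a *: vert_der c + vert_der c' :> (S -> S^o).
Proof.
apply: funext => f.
have -> : (a *: vert_der c + vert_der c') f = a *: vert_der c f + vert_der c' f.
  by [].
rewrite /vert_der /coord_der scaler_sumr -big_split; apply: eq_bigr => j _ /=.
rewrite !ffunE mulrDl; congr (_ + _); exact: esym (mulrA _ _ _).
Qed.

Lemma vert_der_log B c (X : flats 0 B) :
  vert_der c \in log_derivation m (val X).
Proof.
apply/asboolP; split=> [|H]; first exact: coord_der_derivation.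
by rewrite flats0 inE.
Qed.

Definition pres0_fun B c : lsum 0 (layer0 m) B :=
  dsum_fam (fun X : flats 0 B =>
    MkD0 (vert_der_log c X) : lobj (layer0 m) (val X)).

Lemma pres0_fun_linear B : linear (@pres0_fun B).
Proof.
move=> a c c'; apply: dsumP => X.
rewrite dsum_addE dsum_scaleE !dsumE; apply: val_inj.
exact: vert_der_linear.
Qed.

Definition pres0 B : {linear Coch -> lsum 0 (layer0 m) B} :=
  linear_of (@pres0_fun_linear B).

Lemma pres0E B c X : pres0 B c X = MkD0 (vert_der_log c X).
Proof. exact: dsumE. Qed.

Lemma D0_ext B (u v : D0 m B) : (forall i : 'I_l, u 'X_i = v 'X_i) -> u = v.
Proof.
have der (w : D0 m B) : derivation w by have /asboolP[] := D0_valP w.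
move=> uv; apply: val_inj; apply: funext.
by apply: derivation_ext => //; apply: der.
Qed.

(** The empty flat, seen as the flat spanned by a vertex: this form makes
    [clique_flat] applicable. *)
Definition vertex_flat B (i : 'I_l) : flats 0 B :=
  exist _ (within K e [set i])
    (@clique_flat K l e B [set i] 0 (clique_in1 B i) (cards1 i)).

Lemma dhomog0C (a : K) : (a%:MP : S) \is 0.-homog.
Proof. by rewrite -[a%:MP]mulr1 mul_mpolyC dhomogZ // dhomog1. Qed.

Lemma dhomog0_const (p : S) : p \is 0.-homog -> p = (p@_0%MM)%:MP.
Proof.
move=> hp; apply/mpolyP => k; rewrite mcoeffC.
have [->|k0] := eqVneq k 0%MM; first by rewrite mulr1.
by rewrite mulr0 (dhomog_nemf_coeff hp) //= mdeg_eq0.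
Qed.

(** There is just one flat of rank 0, the empty one; [pick] finds it. *)
Definition glue0 (R : comNzRingType) B (f : flats 0 B -> 'I_l -> R) :
    {ffun {set 'I_l} -> R^o} :=
  [ffun s : {set 'I_l} =>
     if [pick X : flats 0 B] is Some X then \sum_(i in s) f X i else 0 : R^o].

Lemma glue0E (R : comNzRingType) B (f : flats 0 B -> 'I_l -> R) X i :
  glue0 f [set i] = f X i.
Proof.
rewrite ffunE; case: pickP => [Y _|/(_ X)//]; rewrite big_set1.
by congr f; apply: val_inj; rewrite !flats0.
Qed.

Lemma pres0_presents : presents m pres0.
Proof.
split.
- move=> B C h c; apply: dsumP => X; rewrite dsumE !pres0E; exact: val_inj.
- move=> B c; split=> [c0 s _ /eqP/cards1P[i ->]|cJ].
    have := pres0E c (vertex_flat B i); rewrite c0 dsum_0E => E.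
    have := congr1 (fun u : D0 m _ => u 'X_i) E => /=.
    by rewrite /vert_der coord_derX => <-; apply: rpred0.
  apply: dsumP => X; rewrite dsum_0E pres0E; apply: D0_ext => i.
  rewrite /= /vert_der coord_derX.
  apply: J_vertex (cJ _ (clique_in1 B i) (cards1 i)).
  by rewrite cards1.
- move=> B y.
  exists (glue0 (fun X i => (y X : D0 m (val X)) 'X_i)); apply: dsumP => X.
  rewrite pres0E; apply: D0_ext => i.
  by rewrite /= /vert_der coord_derX (glue0E _ X).
- move=> B a X; rewrite pres0E => i.
  by rewrite /= /vert_der coord_derX ffunE dhomog0C.
- move=> B y y_hom.
  exists (glue0 (fun X i => ((y X : D0 m (val X)) 'X_i : S)@_0%MM)).
  apply: dsumP => X; rewrite pres0E; apply: D0_ext => i.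
  rewrite /= /vert_der coord_derX ffunE (glue0E _ X).
  by rewrite -dhomog0_const //; apply: y_hom.
Qed.

Lemma cobound_pair c (i j : 'I_l) : (i < j)%N ->
  cobound c [set i; j] = c [set j] - c [set i].
Proof.
move=> ij; have ij' : i != j by rewrite neq_ltn ij.
have Di : [set i; j] :\ i = [set j].
  by apply/setP => h; rewrite !inE; case: eqVneq => //= ->; rewrite (negPf ij').
have Dj : [set i; j] :\ j = [set i].
  apply/setP => h; rewrite !inE; case: (eqVneq h j) => //= [->|_].
    by rewrite eq_sym (negPf ij').
  by rewrite orbF.
have pi : position [set i; j] i = 0%N.
  apply/eqP; rewrite cards_eq0; apply/eqP/setP => h; rewrite !inE.
  by apply/negP => /andP[/orP[]/eqP->]; rewrite ?ltnn // ltnNge (ltnW ij).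
have pj : position [set i; j] j = 1%N.
  rewrite (position_D1 j (i := i)) ?inE ?eqxx // ij Di.
  rewrite [position _ _]eq_card0 // => h; rewrite !inE.
  by apply/negP => /andP[/eqP->]; rewrite ltnn.
rewrite ffunE big_setU1 ?inE //= big_set1 pi pj Di Dj.
by rewrite expr0 expr1 mul1r mulN1r.
Qed.

(** The image of tau_0 is the module of logarithmic derivations of C, and
    theta(x_i - x_j) = c{i} - c{j} is, up to sign, the value of d c at the
    edge. *)
Lemma pres0_rank : rank_kernel m pres0.
Proof.
move=> C _ c.
have pairs H : H \in C -> clique_in C [set (val H).1; (val H).2].
  move=> HC; apply/clique_inP => i j.
  rewrite !inE => i_s j_s ij; exists H => //.
  case/orP: i_s ij => /eqP->; case/orP: j_s => /eqP->; rewrite ?ltnn //.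
    by case: (val H).
  by move=> /(ltn_trans (edge_lt H)); rewrite ltnn.
split=> [c0 s cs card_s|cJ].
- have [t tc] : exists t : D0 m C, tau 0 (t : lobj (layer0 m) C) = pres0 C c.
    exact/asboolP/(proj_quot_eq0 (immod (tau 0 (D := layer0 m) (B := C)))).
  have tX i : t 'X_i = c [set i].
    have := congr1 (fun y : lsum 0 (layer0 m) C => y (vertex_flat C i)) tc.
    rewrite /= dsumE pres0E => E.
    have /= := congr1 (fun u : D0 m _ => u 'X_i) E => ->.
    by rewrite /vert_der coord_derX.
  have [H [HC Es]] : exists H, H \in C /\ s = [set (val H).1; (val H).2].
    have /cards2P[a [b [ab Es]]] : #|s| == 2 by rewrite card_s.
    wlog lt_ab : a b ab Es / (a < b)%N.
      move=> W; move: (ab); rewrite neq_ltn => /orP[|ba]; first exact: W.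
      by apply: (W b a) ba; rewrite 1?eq_sym // setUC.
    have [||H HC HE] := elimT (clique_inP C s) cs a b _ _ lt_ab.
    + by rewrite Es !inE eqxx.
    + by rewrite Es !inE eqxx orbT.
    by exists H; rewrite HE.
  have /asboolP[tD /(_ H HC)[g]] := D0_valP t.
  rewrite form_graphic derivationB // !tX => E.
  rewrite Es cobound_pair ?edge_lt // -opprB rpredN; apply/J_edge; exists g.
  by rewrite form_graphic -E.
- have log : vert_der c \in log_derivation m C.
    apply/asboolP; split=> [|H HC]; first exact: coord_der_derivation.
    rewrite form_graphic derivationB; last exact: coord_der_derivation.
    rewrite /vert_der !coord_derX.
    have card2 : #|[set (val H).1; (val H).2]| = 2 by rewrite cards2 edge_neq.
    have := cJ _ (pairs H HC) card2; rewrite cobound_pair ?edge_lt //.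
    by rewrite -opprB rpredN => /J_edge[g E]; exists g; rewrite E form_graphic.
  have -> : coker_pres pres0 C c = coker_proj 0 (layer0 m) C (pres0 C c) by [].
  have -> : pres0 C c = tau 0 (MkD0 log : lobj (layer0 m) C).
    apply: dsumP => X; rewrite pres0E dsumE; exact: val_inj.
  exact: coker_proj_tau.
Qed.

Fixpoint pres (k : nat) : forall B, {linear Coch -> lsum k (dlayer m k) B} :=
  if k is k'.+1 then next_pres (pres k') else pres0.

Lemma presP k : presents m (pres k) /\ rank_kernel m (pres k).
Proof.
elim: k => [|k [IHp IHr]].
  by split; [apply: pres0_presents | apply: pres0_rank].
split; first exact: next_presents.
apply: (@rank_ker_step K l e m k (next_layer k (dlayer m k)) _
  (fun B => coker_pres (pres k) B
     : {linear Coch -> lobj (next_layer k (dlayer m k)) B})).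
- exact: next_presents.
- exact: coker_pres_onto IHp.
- exact: (next_pres_tau IHp IHr).
Qed.

End Layers.

(** * The two isomorphisms *)
Lemma dsum_sumE (R : pzRingType) (I J : finType) (M : I -> lmodType R)
    (F : J -> dsum M) i : (\sum_j F j) i = \sum_j F j i.
Proof.
apply: (big_morph (fun x : dsum M => x i)) => [x y|].
  exact: dsum_addE.
exact: dsum_0E.
Qed.

Section Isomorphisms.
Variables (K : fieldType) (l : nat) (e : rel 'I_l).
Variable m : hyp (graphic K e) -> nat.
Local Notation S := {mpoly K[l]}.
Local Notation A := (graphic K e).
Local Notation Coch := {ffun {set 'I_l} -> S^o}.
Implicit Types (B C : {set hyp A}) (s t : {set 'I_l}) (c : Coch).

Definition on_simplices k c : cochain K e k :=
  dsum_fam (fun s : simplex e k => c (val s) : S^o).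

Lemma on_simplices_linear k : linear (@on_simplices k).
Proof.
move=> a c c'; apply: dsumP => s.
by rewrite dsum_addE dsum_scaleE !dsumE.
Qed.

HB.instance Definition _ k := GRing.isLinear.Build S Coch (cochain K e k) *:%R
  (@on_simplices k) (@on_simplices_linear k).

Lemma on_simplices_onto k (w : cochain K e k) : exists c, on_simplices k c = w.
Proof.
exists [ffun s : {set 'I_l} =>
  if insub s is Some s' then w (s' : simplex e k) else 0 : S^o].
by apply: dsumP => s; rewrite dsumE ffunE valK.
Qed.

Lemma reduceJ_linear k : linear (@reduceJ K l e m k).
Proof.
move=> a w w'; apply: dsumP => s.
by rewrite dsum_addE dsum_scaleE !dsumE [LHS]linearP.
Qed.

HB.instance Definition _ k := GRing.isLinear.Build S (cochain K e k)
  (cochainJ m k) *:%R (@reduceJ K l e m k) (@reduceJ_linear k).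

Lemma reduceJ_onto k (w : cochainJ m k) : exists w', reduceJ m w' = w.
Proof.
exists (dsum_fam (fun s : simplex e k => repr (w s))); apply: dsumP => s.
by rewrite !dsumE /proj_quot reprK.
Qed.

Lemma coboundary_linear k : linear (@coboundary K l e k).
Proof.
move=> a w w'; apply: dsumP => s.
rewrite dsum_addE dsum_scaleE !dsumE scaler_sumr -big_split /=.
by apply: eq_bigr => i _; rewrite dsum_addE dsum_scaleE mulrDr -!scalerAr.
Qed.

HB.instance Definition _ k := GRing.isLinear.Build S (cochain K e k)
  (cochain K e k.+1) *:%R (@coboundary K l e k) (@coboundary_linear k).

Lemma coboundary_on_simplices k c :
  coboundary (on_simplices k c) = on_simplices k.+1 (cobound c).
Proof.
apply: dsumP => s; rewrite !dsumE [RHS]big_sub /=.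
by apply: eq_bigr => i _; rewrite dsumE.
Qed.

Hypothesis e_sym : forall i j, e i j = e j i.

Definition Dpres k : {linear Coch -> Dcpx m k} := pres m k setT.

Definition Jpres k : {linear Coch -> cochainJ m k} :=
  @reduceJ K l e m k \o @on_simplices k.

Lemma Dpres_delta k c : delta m k (Dpres k c) = Dpres k.+1 (cobound c).
Proof. by have [hp hr] := presP m k; apply: (next_pres_tau hp hr). Qed.

Lemma Dpres_onto k x : exists c, Dpres k c = x.
Proof. by have [hp _] := presP m k; apply: (pres_onto hp). Qed.

Lemma Jpres_onto k x : exists c, Jpres k c = x.
Proof.
have [w <-] := reduceJ_onto x; have [c <-] := on_simplices_onto w.
by exists c.
Qed.

Lemma Dpres_ker k c : Dpres k c = 0 <-> Jpres k c = 0.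
Proof.
have [hp _] := presP m k; apply: iff_trans (pres_ker hp _ _) _; split=> h.
  apply: dsumP => s; rewrite dsum_0E !dsumE; apply/proj_quot_eq0.
  have := valP s; rewrite (@clique_setT K) // => /andP[/eqP card_s cs].
  exact: h.
move=> s cs card_s.
have sP : (#|s| == k.+1) && clique e s.
  by rewrite (@clique_setT K) // card_s eqxx.
have := congr1 (fun w : cochainJ m k => w (exist _ s sP)) h.
by rewrite /= dsum_0E !dsumE => /proj_quot_eq0.
Qed.

Definition psi k : {linear Dcpx m k -> cochainJ m k} :=
  sval (linear_factor (@Dpres_onto k) (fun c => proj1 (Dpres_ker k c))).

Lemma psiE k c : psi k (Dpres k c) = Jpres k c.
Proof. by rewrite /psi; case: linear_factor => f fE; apply: fE. Qed.

Lemma psi_bij k : bijective (psi k).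
Proof.
apply: linear_factor_bij (@Dpres_onto k) (@Jpres_onto k) _ (@psiE k).
by move=> c /Dpres_ker.
Qed.

Lemma psi_delta k x : psi k.+1 (delta m k x) = coboundaryJ (psi k x).
Proof.
have [c <-] := Dpres_onto x; rewrite Dpres_delta !psiE /Jpres /=.
by rewrite coboundaryJE coboundary_on_simplices.
Qed.

Hypothesis m_pos : forall H, (0 < m H)%N.
Local Notation KCoch := {ffun {set 'I_l} -> K^o}.
Implicit Types (a : KCoch).

Lemma constc_linear (x : K) a a' :
  constc (x *: a + a') = x%:MP *: constc a + constc a'.
Proof. by apply/ffunP => s; rewrite !ffunE mpolyCD mpolyCM. Qed.

Lemma Dpres_deg0 k a : Dpres k (constc a) \in @Defs.deg0 K l A m k.
Proof.
by apply/asboolP => X; have [hp _] := presP m k; apply: pres_hom hp _ _ _.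
Qed.

Definition Dpres0_fun k a : Dcpx0 m k := MkDcpx0 (Dpres_deg0 k a).

Lemma Dpres0_linear k : linear (@Dpres0_fun k).
Proof.
move=> x a a'; apply: val_inj; apply: etrans (linearP (Dpres k) x%:MP _ _).
by rewrite /= constc_linear.
Qed.

Definition Dpres0 k : {linear KCoch -> Dcpx0 m k} :=
  linear_of (@Dpres0_linear k).

Lemma Dpres0_onto k v : exists a, Dpres0 k a = v.
Proof.
have [hp _] := presP m k; have /asboolP v0 := Dcpx0_valP v.
by have [a av] := pres_onto_hom hp v0; exists a; apply: val_inj.
Qed.

Definition Cpres0_fun k a : restr (cochain K e k) := on_simplices k (constc a).

Lemma Cpres0_linear k : linear (@Cpres0_fun k).
Proof.
move=> x a a'; apply: etrans (linearP (@on_simplices k) x%:MP _ _).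
by rewrite /Cpres0_fun constc_linear.
Qed.

Definition Cpres0 k : {linear KCoch -> restr (cochain K e k)} :=
  linear_of (@Cpres0_linear k).

Lemma Cpres0E k a (s : simplex e k) :
  (Cpres0 k a : cochain K e k) s = (a (val s))%:MP.
Proof. by rewrite dsumE ffunE. Qed.

(** A K-valued cochain dies in the derivation complex only if its values at the
    simplices are constants in J, that is, zero. *)
Lemma Dpres0_ker k a : Dpres0 k a = 0 <-> Cpres0 k a = 0.
Proof.
split=> [a0|a0].
  have /Dpres_ker aJ : Dpres k (constc a) = 0 := congr1 val a0.
  apply: dsumP => s; rewrite Cpres0E dsum_0E.
  have := congr1 (fun w : cochainJ m k => w s) aJ.
  rewrite /= dsum_0E !dsumE => /proj_quot_eq0/(J_const m_pos)->.
  exact: mpolyC0.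
apply: val_inj; apply/Dpres_ker; rewrite /Jpres /=.
by rewrite (a0 : on_simplices k (constc a) = 0) linear0.
Qed.

(** The coordinates of the degree 0 elements in the K-basis of simplices. *)
Definition coords k : {linear Dcpx0 m k -> restr (cochain K e k)} :=
  sval (linear_factor (@Dpres0_onto k) (fun a => proj1 (Dpres0_ker k a))).

Lemma coordsE k a : coords k (Dpres0 k a) = Cpres0 k a.
Proof. by rewrite /coords; case: linear_factor => f fE; apply: fE. Qed.

Definition chi k : {linear Scpx m k -> cochain K e k} := tensor_lift (coords k).

Lemma chi_tens k a : chi k (tens l (Dpres0 k a)) = on_simplices k (constc a).
Proof. by apply: etrans (tensor_liftE (coords k) _) _; apply: coordsE. Qed.

Definition chi_inv_fun k (w : cochain K e k) : Scpx m k :=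
  \sum_(s : simplex e k) (w s : S) *: tens l (Dpres0 k (single (val s) 1)).

Lemma chi_inv_linear k : linear (@chi_inv_fun k).
Proof.
move=> x w w'; rewrite /chi_inv_fun scaler_sumr -big_split.
apply: eq_bigr => s _ /=.
by rewrite dsum_addE dsum_scaleE scalerDl -scalerA.
Qed.

Definition chi_inv k : {linear cochain K e k -> Scpx m k} :=
  linear_of (@chi_inv_linear k).

(** A degree 0 element is the combination of the basis elements with its
    coordinates as coefficients, and both sides are linear. *)
Lemma chiK k : cancel (chi k) (chi_inv k).
Proof.
pose f : {linear Scpx m k -> Scpx m k} := chi_inv k \o chi k.
pose g : {linear Scpx m k -> Scpx m k} := idfun.
apply: (tensor_ext (f := f) (g := g)) => v.
have [a <-] := Dpres0_onto v.
transitivity (chi_inv_fun (chi k (tens l (Dpres0 k a)))) => //.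
rewrite chi_tens /chi_inv_fun.
have T_linear : linear (fun u : Dcpx0 m k => tens l u : restr (Scpx m k)).
  by move=> x u u'; apply: tens_linear.
pose T := linear_of T_linear.
transitivity
  (T (Dpres0 k (\sum_(s : simplex e k) a (val s) *: single (val s) 1))).
  rewrite !linear_sum; apply: eq_bigr => s _.
  by rewrite dsumE ffunE 2!linearZ.
congr (T _ : Scpx m k); apply/eqP; rewrite -subr_eq0 -linearB.
apply/eqP/Dpres0_ker.
apply: dsumP => s; rewrite Cpres0E dsum_0E !ffunE sum_ffunE (bigD1 s) //=.
rewrite !ffunE eqxx big1 => [|t ts]; last first.
  by rewrite !ffunE eq_sym val_eqE (negPf ts) scaler0.
by rewrite addr0 [_ *: _]mulr1 subrr mpolyC0.
Qed.

Lemma chi_invK k : cancel (chi_inv k) (chi k).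
Proof.
move=> w; transitivity (\sum_(t : simplex e k)
    chi k ((w t : S) *: tens l (Dpres0 k (single (val t) 1)))).
  exact: linear_sum.
apply: dsumP => s; rewrite dsum_sumE.
have E (t : simplex e k) :
    chi k ((w t : S) *: tens l (Dpres0 k (single (val t) 1))) s =
      (w t : S) * (val s == val t)%:R.
  rewrite linearZ dsum_scaleE chi_tens dsumE !ffunE.
  by case: eqP => _; rewrite ?mpolyC1 ?mpolyC0.
rewrite (bigD1 s) //= E eqxx mulr1 big1 ?addr0 // => t ts.
by rewrite E eq_sym val_eqE (negPf ts) mulr0.
Qed.

Lemma chi_bij k : bijective (chi k).
Proof. by exists (chi_inv k); [apply: chiK | apply: chi_invK]. Qed.

Lemma chi_delta k x : chi k.+1 (Sdelta m k x) = coboundary (chi k x).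
Proof.
pose f : {linear Scpx m k -> cochain K e k.+1} := chi k.+1 \o Sdelta m k.
pose g : {linear Scpx m k -> cochain K e k.+1} := @coboundary K l e k \o chi k.
move: x; apply: (tensor_ext (f := f) (g := g)) => v.
have [a <-] := Dpres0_onto v.
transitivity (chi k.+1 (tens l (delta0 (Dpres0 k a)))).
  congr (chi k.+1 _); exact: tensor_liftE.
have -> : delta0 (Dpres0 k a) = Dpres0 k.+1 (cobound a).
  apply: val_inj; apply: etrans (Dpres_delta k (constc a)) _.
  by rewrite cobound_constc.
apply: etrans (chi_tens _ _) _.
transitivity (coboundary (chi k (tens l (Dpres0 k a)))) => //.
by rewrite chi_tens coboundary_on_simplices cobound_constc.
Qed.

Lemma chi_homog k (v : Dcpx0 m k) (s : simplex e k) :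
  chi k (tens l v) s \is 0.-homog.
Proof.
have [a <-] := Dpres0_onto v.
by rewrite chi_tens dsumE ffunE; apply: dhomog0C.
Qed.

Lemma psi_chi k x : psi k (Scpx_surj m k x) = reduceJ m (chi k x).
Proof.
pose f : {linear Scpx m k -> cochainJ m k} := psi k \o Scpx_surj m k.
pose g : {linear Scpx m k -> cochainJ m k} := @reduceJ K l e m k \o chi k.
move: x; apply: (tensor_ext (f := f) (g := g)) => v.
have [a <-] := Dpres0_onto v.
transitivity (psi k (Dpres k (constc a))).
  congr (psi k _); exact: tensor_liftE.
rewrite psiE; transitivity (reduceJ m (chi k (tens l (Dpres0 k a)))) => //.
by rewrite chi_tens.
Qed.

End Isomorphisms.

Theorem proposition5p11 (K : fieldType) (l : nat) (e : rel 'I_l)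
    (e_sym : forall i j, e i j = e j i) (e_irr : forall i, ~~ e i i)
    (m : hyp (graphic K e) -> nat) (m_pos : forall H, (0 < m H)%N) :
  exists (psi : forall k : nat, {linear Dcpx m k -> cochainJ m k})
         (chi : forall k : nat, {linear Scpx m k -> cochain K e k}),
    [/\ (forall k, bijective (psi k)),
        (forall k x, psi k.+1 (delta m k x) = coboundaryJ (psi k x)) &
        [/\ (forall k, bijective (chi k)),
            (forall k x, chi k.+1 (Sdelta m k x) = coboundary (chi k x)),
            (forall k (v : Dcpx0 m k) (s : simplex e k),
               chi k (tens l v) s \is 0.-homog) &
            (forall k x, psi k (Scpx_surj m k x) = reduceJ m (chi k x))]].
Proof.
exists (psi m e_sym), (chi e_sym m_pos).
split; [exact: psi_bij | exact: psi_delta | split].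
- exact: chi_bij.
- exact: chi_delta.
- exact: chi_homog.
- exact: psi_chi.
Qed.
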